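(* Let $G$ and $H$ be separable real Hilbert spaces, let $S$ be the unit sphere of $G$, let $L, C\colon G\to H$ be bounded linear operators and let $N\colon S\to H$ be a continuous map. Consider the problem $$Lx+\varepsilon N(x)=\lambda Cx,\qquad x\in S,\qquad \varepsilon,\lambda\in\mathbb{R},$$ let $\Sigma\subseteq S\times\mathbb{R}\times\mathbb{R}$ be the set of its solutions $(x,\varepsilon,\lambda)$, and let $\Sigma_0=\{(x,\varepsilon,\lambda)\in\Sigma:\varepsilon=0\}$ be the set of its trivial solutions. Assume that $N$ and $C$ are compact and that $p_*=(x_*,0,\lambda_* )\in\Sigma_0$ is a simple solution. Then the set $\Sigma\setminus\Sigma_0$ of the nontrivial solutions has a connected subset whose closure in $\Sigma$ contains $p_*$ and is either unbounded or meets a trivial solution $p^*\in\Sigma_0$ with $p^*\neq p_*$.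
   Context: A trivial solution $(x_*,0,\lambda_* )$ of the problem (i.e. $x_*\in S$, $\lambda_*\in\mathbb{R}$, $Lx_*=\lambda_*Cx_*$) is called simple if the operator $A=L-\lambda_*C$ satisfies: (1) $\operatorname{Ker}A=\mathbb{R}x_*$; (2) $Cx_*\neq 0$; (3) $\operatorname{Im}A\oplus C(\operatorname{Ker}A)=H$. A continuous map between metric spaces is called compact if it sends bounded subsets of its domain into relatively compact subsets of its codomain (this applies to both $C\colon G\to H$ and $N\colon S\to H$). $S\times\mathbb{R}\times\mathbb{R}$ is regarded as a subset of the Hilbert space $G\times\mathbb{R}\times\mathbb{R}$ with its natural inner product; boundedness and topology on $\Sigma$ are those inherited from this space. *)

(* Defs.v *)
From HB Require Import structures.
From mathcomp Require Import all_boot all_order all_algebra.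
From mathcomp Require Import all_classical all_reals all_analysis.

Set Implicit Arguments.
Unset Strict Implicit.
Unset Printing Implicit Defensive.

Import Order.TTheory GRing.Theory Num.Theory.
Import numFieldNormedType.Exports.

Local Open Scope classical_set_scope.
Local Open Scope ring_scope.

HB.mixin Record isHilbert (R : realType) V & CompleteNormedModule R V := {
  inner : {dot V for idfun} ;
  inner_norm : forall x : V, inner x x = `|x| ^+ 2
}.

#[short(type="hilbertType")]
HB.structure Definition Hilbert (R : realType) :=
  {V of CompleteNormedModule R V & isHilbert R V}.

Definition separable (T : topologicalType) : Prop :=
  exists2 D : set T, countable D & dense D.

Section Operators.
Context {R : realType} {V W : normedModType R}.

Definition sphere : set V := [set x | `|x| = 1].

Definition bounded_operator (f : {linear V -> W}) : Prop :=
  exists M : R, forall x, `|f x| <= M * `|x|.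

(* A map on D is a total function of which only the values on D matter;
   compactness includes continuity (for the subspace topology of D). *)
Definition compact_map (D : set V) (f : V -> W) : Prop :=
  {within D, continuous f} /\
  forall B : set V, B `<=` D -> bounded_set B -> precompact (f @` B).

Definition kernel (f : V -> W) : set V := [set x | f x = 0].

(* W is the algebraic internal direct sum of its linear subspaces A and B. *)
Definition direct_sum (A B : set W) : Prop :=
  (forall w, exists a b, [/\ A a, B b & w = a + b]) /\ A `&` B = [set 0].

End Operators.

Section EigenvalueProblem.
Context {R : realType} {G H : hilbertType R}.
Variables (L C : {linear G -> H}) (N : G -> H).

(* The product carries the sup norm, which is equivalent to the Hilbert norm
   of G x R x R, hence has the same topology and the same bounded sets. *)
Definition solutions : set (G * R * R) :=
  [set p | sphere p.1.1 /\ L p.1.1 + p.1.2 *: N p.1.1 = p.2 *: C p.1.1].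

Definition trivial_solutions : set (G * R * R) :=
  solutions `&` [set p | p.1.2 = 0].

Definition simple_solution (p : G * R * R) : Prop :=
  let A := fun x => L x - p.2 *: C x in
  [/\ trivial_solutions p,
      kernel A = range (fun t : R => t *: p.1.1),
      C p.1.1 != 0 &
      direct_sum (range A) (C @` kernel A)].

End EigenvalueProblem.

(* Main.v *)
(* Write the problem as a fixed point problem.  The bordered operator
   B x = L x - ls C x + <x, xs> C xs is bijective because xs is simple, and its
   inverse is bounded by the open mapping theorem.  Applying it turns the
   solutions (x, e, l) into the fixed points z = k (z, e), z = (x, l), of a
   compact map k such that k (., 0) - z0 is quadratically small at z0 = (xs, ls).

   Degree theory is only needed to show that the solution set S does not split
   as P + Q, with P and Q closed and disjoint, P bounded, and (z0, 0) the only
   trivial solution in P.  Let phi be a Urysohn function equal to 1 on P and to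
   -1 on Q, far away, and on the slice e = 0 away from z0.  Then
     (z, e) |-> (z0 + (1 - |phi|) (k (z, e) - z0), max 0 (min (e + phi) r))
   is a compact map without fixed points, contradicting Schauder's theorem.
   The latter is deduced from Brouwer's theorem on simplices, itself obtained
   from Scarf's combinatorial lemma.

   Finally, Zorn's lemma gives a minimal closed subset of S containing (z0, 0)
   that does not split; it becomes connected once its trivial solutions are
   removed. *)

From HB Require Import structures.
Require Import Defs.
From mathcomp Require Import all_boot all_order all_algebra.
From mathcomp Require Import zify.

Set Implicit Arguments.
Unset Strict Implicit.
Unset Printing Implicit Defensive.

(** * Scarf's lemma *)

Section Scarf.
Variables (I T : finType) (r : I -> T -> nat) (s : I -> T) (c : T -> I).
Hypothesis r_inj : forall i, injective (r i).
Hypothesis s_min : forall i t, r i (s i) <= r i t.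
Hypothesis s_max : forall i j t, i != j -> t \notin codom s -> r i t < r i (s j).
Hypothesis c_s : forall i, c (s i) = i.
Variable t0 : T.
Hypothesis t0_grid : t0 \notin codom s.

(** Scarf's primitive sets: no point exceeds, in every order [i] at once, some element of [X]. *)
Definition undominated (X : {set T}) :=
  [forall t, exists i, forall x in X, r i t <= r i x].

Lemma undominatedP (X : {set T}) :
  reflect (forall t, exists i, forall x, x \in X -> r i t <= r i x)
          (undominated X).
Proof.
apply: (iffP forallP) => h t; have := h t.
  by case/existsP => i /forall_inP hi; exists i.
by case=> i hi; apply/existsP; exists i; apply/forall_inP.
Qed.

Lemma undominatedS (X Y : {set T}) :
  Y \subset X -> undominated X -> undominated Y.
Proof.
move=> /subsetP YX /undominatedP hX; apply/undominatedP => t.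
by have [i hi] := hX t; exists i => x /YX; exact: hi.
Qed.

Let bot (Y : {set T}) (y0 : T) (i : I) := [arg min_(y < y0 in Y) r i y].

(** For [i != i0] the slack [s i] is in the door and is the minimum of order [i], so only order [i0]
    can protect the other points. The added point must be the [r i0]-largest non-slack one. *)
Lemma slack_door_unique (i0 : I) :
  #|[set x | (x \notin s @: [set~ i0]) && undominated (x |: s @: [set~ i0])]|
    = 1.
Proof.
set Y := s @: _.
have s_inj : injective s by move=> i j /(congr1 c); rewrite !c_s.
have sY i : i != i0 -> s i \in Y.
  by move=> ii; apply: imset_f; rewrite in_setC1.
have gY t : t \notin codom s -> t \notin Y.
  by apply: contra => /imsetP[i _ ->]; exact: codom_f.
pose x0 := [arg max_(x > t0 | x \notin codom s) r i0 x].
have [x0g x0max] : x0 \notin codom s /\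
    forall t, t \notin codom s -> r i0 t <= r i0 x0.
  by rewrite /x0; case: arg_maxnP.
apply/eqP/cards1P; exists x0; apply/setP => x; rewrite !inE.
apply/andP/eqP => [[xY /undominatedP dX]|->].
  have key i t : (forall x1, x1 \in x |: Y -> r i t <= r i x1) ->
      i != i0 -> t = s i.
    move=> h /sY sYi; apply: (@r_inj i); apply/eqP.
    by rewrite eqn_leq s_min h // inE sYi orbT.
  have xg : x \notin codom s.
    apply/negP => /codomP[i xs].
    have ii : i = i0 by apply/eqP; apply: contraR xY => /sY; rewrite xs.
    have [j hj] := dX t0.
    have [jj|/(key _ _ hj) t0s] := eqVneq j i0; last first.
      by move: t0_grid; rewrite t0s codom_f.
    have := hj x; rewrite !inE eqxx /= => /(_ isT).
    rewrite xs ii jj => h.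
    have e : t0 = s i0 by apply: (@r_inj i0); apply/eqP; rewrite eqn_leq h s_min.
    by move: t0_grid; rewrite e codom_f.
  have [j hj] := dX x0.
  have [jj|/(key _ _ hj) xs] := eqVneq j i0; last first.
    by move: x0g; rewrite xs codom_f.
  apply: (@r_inj i0); apply/eqP; rewrite eqn_leq x0max //=.
  by rewrite -jj hj // !inE eqxx.
split; first exact: gY.
apply/undominatedP => t.
have [/codomP[i ->]|tg] := boolP (t \in codom s); first by exists i => *; exact: s_min.
exists i0 => x1; rewrite in_setU1 => /orP[/eqP->|/imsetP[j]]; first exact: x0max.
rewrite in_setC1 => ji ->; apply: ltnW; apply: s_max => //; by rewrite eq_sym.
Qed.

(** The count is 0 or 2. The minima [m i] of the orders exhaust [Y], which has one point fewer than
    there are orders, so just one pair of orders [j1], [j2] shares its minimum. A point completing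
    [Y] takes over the minimum of one of the two and is then determined. *)
Lemma door_even (i0 : I) (Y : {set T}) :
  #|Y|.+1 = #|I| -> c @: Y = [set~ i0] -> Y != s @: [set~ i0] ->
  ~~ odd #|[set x | (x \notin Y) && undominated (x |: Y)]|.
Proof.
move=> cardY cY Ys.
set D := [set x | _].
have [->|[x1 x1D]] := set_0Vmem D; first by rewrite cards0.
have domY : undominated Y.
  move: x1D; rewrite inE => /andP[_]; apply: undominatedS; exact: subsetUr.
have s_inj : injective s by move=> i j /(congr1 c); rewrite !c_s.
have cardC1 : #|[set~ i0]| = #|Y|.
  have := cardsC1 i0; lia.
have [yg yY ygg] : exists2 y, y \in Y & y \notin codom s.
  apply/exists_inP; apply: contraR Ys; rewrite negb_exists_in => /forall_inP h.
  have sub : Y \subset s @: [set~ i0].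
    apply/subsetP => y yY; have /negPn/codomP[i yi] := h _ yY.
    rewrite yi imset_f // -cY; apply/imsetP; exists y => //.
    by rewrite yi c_s.
  by rewrite eqEcard sub card_imset // cardC1 leqnn.
pose m := bot Y yg.
have mP i : m i \in Y /\ forall y, y \in Y -> r i (m i) <= r i y.
  by rewrite /m /bot; case: arg_minnP.
have m_uniq i y : (forall z, z \in Y -> r i y <= r i z) -> y \in Y -> y = m i.
  move=> h yY'; apply: (@r_inj i); apply/eqP.
  by rewrite eqn_leq h ?(mP i).1 // (mP i).2.
have m_onto : m @: setT = Y.
  apply/eqP; rewrite eqEsubset; apply/andP; split.
    by apply/subsetP => _ /imsetP[i _ ->]; exact: (mP i).1.
  apply/subsetP => y yY'; have [i hi] := undominatedP _ domY y.
  by rewrite (m_uniq i y) // imset_f.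
have [j1 [j2 [j12 mj12]]] : exists j1 j2, j1 != j2 /\ m j1 = m j2.
  have /injectivePn[j1 [j2 h1 h2]] : ~~ injectiveb m.
    apply/negP => /injectiveP/card_codom.
    have -> : #|codom m| = #|Y|.
      by apply: eq_card => y; rewrite -m_onto; apply/codomP/imsetP => [[i ->]|[i _ ->]]; exists i.
    move: cardY; lia.
  by exists j1, j2.
have minj j : j = j1 \/ j = j2 -> {in [set~ j] &, injective m} /\
     m @: [set~ j] = Y.
  move=> jj.
  have onto : m @: [set~ j] = Y.
    apply/eqP; rewrite eqEsubset; apply/andP; split.
      by apply/subsetP => _ /imsetP[i _ ->]; exact: (mP i).1.
    rewrite -m_onto; apply/subsetP => _ /imsetP[i _ ->].
    have [->|ij] := eqVneq i j; last by rewrite imset_f // in_setC1.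
    by case: jj => ->; [rewrite mj12|rewrite -mj12]; rewrite imset_f // in_setC1 // eq_sym.
  split => //; apply/imset_injP; rewrite onto.
  by have := cardsC1 j; lia.
have m12 i i' : m i = m i' -> i != i' -> (i = j1 /\ i' = j2) \/ (i = j2 /\ i' = j1).
  move=> e ii.
  have [a _] := minj j1 (or_introl erefl); have [b _] := minj j2 (or_intror erefl).
  have := a i i'; have := b i i'; rewrite !inE.
  have [ij1|] := eqVneq i j1.
    have [ij2|] := eqVneq i' j2; first by left.
    move=> i'j2; rewrite ij1 j12 /=.
    by move=> /(_ isT isT); rewrite -ij1 e => /(_ erefl) h; rewrite h eqxx in ii.
  have [i'j1|] := eqVneq i' j1.
    have [ij2|] := eqVneq i j2; first by right.
    move=> _ _; rewrite i'j1 j12 /=.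
    by move=> /(_ isT isT); rewrite e i'j1 => /(_ erefl) h; rewrite h i'j1 eqxx in ii.
  by move=> _ _ _ /(_ isT isT e) h; rewrite h eqxx in ii.
(* [A j] holds the points above the minimum of [Y] in every order but [j]. The only point that can
   become the new minimum of order [j] is its [r j]-largest element [b j]. *)
pose A j := [set t | [forall (i | i != j), r i (m i) < r i t]].
have AP j t : reflect (forall i, i != j -> r i (m i) < r i t) (t \in A j).
  by rewrite inE; apply: forall_inP.
have sA j : s j \in A j.
  apply/AP => i ij; apply: (leq_ltn_trans ((mP i).2 _ yY)); exact: s_max.
pose b j := [arg max_(x > s j in A j) r j x].
have bP j : b j \in A j /\ forall t, t \in A j -> r j t <= r j (b j).
  by rewrite /b; case: arg_maxnP; first exact: sA.
have DE : D = [set b j1; b j2].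
  apply/setP => x; rewrite !inE; apply/andP/orP; last first.
    have aux j : j = j1 \/ j = j2 -> x == b j -> x \notin Y /\ undominated (x |: Y).
      move=> /minj[injj ontoj] /eqP->; split.
        apply/negP => bY; move: (bY); rewrite -{1}ontoj => /imsetP[i].
        rewrite in_setC1 => ij e.
        by have := (elimT (AP _ _) (bP j).1) _ ij; rewrite -e ltnn.
      apply/undominatedP => t; have [tA|tA] := boolP (t \in A j).
        exists j => y; rewrite in_setU1 => /orP[/eqP->|yY']; first exact: (bP j).2.
        have [i hi] := undominatedP _ domY t.
        have [<-|ij] := eqVneq i j; first exact: hi.
        have := (elimT (AP _ _) tA) _ ij; rewrite ltnNge hi //; exact: (mP i).1.
      have /forall_inPn[i ij]: ~~ [forall (i | i != j), r i (m i) < r i t].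
        by move: tA; rewrite inE.
      rewrite -leqNgt => h; exists i => y; rewrite in_setU1 => /orP[/eqP->|yY'].
        by apply: leq_trans h (ltnW _); exact: (elimT (AP _ _) (bP j).1).
      exact: leq_trans h ((mP i).2 _ yY').
    case=> h; [apply: (aux j1) => //; by left|apply: (aux j2) => //; by right].
  move=> [xY /undominatedP dX].
  (* In the room [x |: Y] the minima [mX] are pairwise distinct: [x] is that of one order [j], and
     the others are unchanged. *)
  pose mX := bot (x |: Y) x.
  have mXP i : mX i \in x |: Y /\ forall y, y \in x |: Y -> r i (mX i) <= r i y.
    by rewrite /mX /bot; case: arg_minnP; first by rewrite !inE eqxx.
  have mX_uniq i y : (forall z, z \in x |: Y -> r i y <= r i z) -> y \in x |: Y -> y = mX i.
    move=> h yY'; apply: (@r_inj i); apply/eqP.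
    by rewrite eqn_leq h ?(mXP i).1 // (mXP i).2.
  have mX_onto : mX @: setT = x |: Y.
    apply/eqP; rewrite eqEsubset; apply/andP; split.
      by apply/subsetP => _ /imsetP[i _ ->]; exact: (mXP i).1.
    apply/subsetP => y yY'; have [i hi] := dX y.
    by rewrite (mX_uniq i y) // imset_f.
  have mX_inj : injective mX.
    move=> i i'; apply: (elimT imset_injP) => //; rewrite mX_onto.
    by rewrite cardsU1 xY cardsT; lia.
  have /imsetP[j _ xj] : x \in mX @: setT by rewrite mX_onto !inE eqxx.
  have mXE i : i != j -> mX i = m i.
    move=> ij; have [+ h] := mXP i.
    rewrite in_setU1 => /orP[/eqP e|]; last first.
      by apply: m_uniq => z zY; apply: h; rewrite in_setU1 zY orbT.
    have /mX_inj ei : mX i = mX j by rewrite -xj.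
    by rewrite ei eqxx in ij.

  have xA : x \in A j.
    apply/AP => i ij; rewrite -mXE // ltn_neqAle (mXP i).2 ?in_setU1 ?eqxx // andbT.
    by apply/negP => /eqP/r_inj; rewrite xj => /mX_inj ei; rewrite ei eqxx in ij.
  have xmax t : t \in A j -> r j t <= r j x.
    move=> tA; have [i hi] := dX t; have [<-|ij] := eqVneq i j.
      by apply: hi; rewrite in_setU1 eqxx.
    have := hi (m i); rewrite in_setU1 (mP i).1 orbT => /(_ isT).
    by rewrite leqNgt (elimT (AP _ _) tA).
  have xb : x = b j.
    by apply: (@r_inj j); apply/eqP; rewrite eqn_leq (bP j).2 ?xmax ?(bP j).1.
  have : j = j1 \/ j = j2.
    have [|jj1] := eqVneq j j1; first by left.
    have [|jj2] := eqVneq j j2; first by right.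
    have /mX_inj e : mX j1 = mX j2 by rewrite !mXE // eq_sym.
    by rewrite e eqxx in j12.
  by case=> <-; [left|right]; rewrite xb.
(* If [b j1 = b j2], that point exceeds the minimum of [Y] in every order, against [domY]. *)
rewrite DE cards2; case: eqVneq => // e.
have [i hi] := undominatedP _ domY (b j1).
have [j ij bjA] : exists2 j, i != j & b j1 \in A j.
  have [ij|] := eqVneq i j1; last by exists j1; rewrite ?(bP j1).1.
  by exists j2; [rewrite ij|rewrite e (bP j2).1].
by have := elimT (AP _ _) bjA i ij; rewrite ltnNge hi // (mP i).1.
Qed.

(** If some removal leaves exactly the labels other than [i0], two points of the room share a label
    and all other labels occur once; the two doors come from removing one of these points. *)
Lemma room_even (i0 : I) (X : {set T}) :
  #|X| = #|I| -> c @: X != setT ->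
  ~~ odd #|[set x in X | c @: (X :\ x) == [set~ i0]]|.
Proof.
move=> cardX cX; set D := [set x in X | _].
have [->|[x1]] := set_0Vmem D; first by rewrite cards0.
rewrite inE => /andP[x1X /eqP ex1].
have cXE : c @: X = [set~ i0].
  apply/eqP; rewrite eq_sym eqEsubset -{1}ex1 imsetS ?subD1set //=.
  apply/subsetP => i iX; rewrite in_setC1; apply: contra cX => /eqP ii.
  rewrite -subTset; apply/subsetP => j _.
  have [->|ji] := eqVneq j i0; first by rewrite -ii.
  have : j \in c @: (X :\ x1) by rewrite ex1 in_setC1.
  by apply: subsetP; apply/imsetS/subD1set.
have : c x1 \in c @: (X :\ x1) by rewrite ex1 -cXE imset_f.
move=> /imsetP[x2]; rewrite !inE => /andP[x21 x2X] c12.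
have cards : #|[set~ i0]| = #|X :\ x1|.
  by have := cardsC1 i0; have := cardsD1 x1 X; rewrite x1X; lia.
have injX : {in X :\ x1 &, injective c} by apply/imset_injP; rewrite ex1 cards.
have -> : D = [set x1; x2].
  apply/setP => x; rewrite !inE; apply/andP/orP.
    move=> [xX /eqP e]; apply/orP; case: eqVneq => //= xx1.
    have injx : {in X :\ x &, injective c}.
      apply/imset_injP; rewrite e cards.
      by have := cardsD1 x1 X; have := cardsD1 x X; rewrite x1X xX; lia.
    apply: contraT => xx2.
    have : x1 = x2 by apply: injx => //; rewrite !inE eq_sym ?xx1 ?xx2.
    by move=> x12; rewrite x12 eqxx in x21.
  case=> /eqP ->; first by rewrite x1X ex1.
  split=> //; rewrite eqEsubset -{1}cXE imsetS ?subD1set //= -ex1.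
  apply/subsetP => i /imsetP[y]; rewrite !inE => /andP[yx1 yX] ->.
  have [->|yx2] := eqVneq y x2; last by rewrite imset_f // !inE yx2.
  by rewrite -c12 imset_f // !inE eq_sym x21.
by rewrite cards2 eq_sym x21.
Qed.

Lemma odd_sum_even (A : finType) (P : pred A) (F : A -> nat) :
  (forall a, P a -> ~~ odd (F a)) -> ~~ odd (\sum_(a | P a) F a).
Proof.
move=> h; elim/big_rec : _ => // a n Pa IH.
by rewrite oddD (negbTE (h _ Pa)).
Qed.

(* Door-to-door parity argument: a door is a set of #|I| - 1 points carrying
   all the labels but i0, a room an undominated set of #|I| points.  Every door
   opens on an even number of rooms, except the one made of slacks only. *)
Theorem scarf : exists2 X, undominated X & c @: X = setT.
Proof.
have i0 : I := c t0.
suff /exists_inP[X dX /eqP cX] : [exists (X | undominated X), c @: X == setT].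
  by exists X.
apply: contraT; rewrite negb_exists_in => /forall_inP nX.
have s_inj : injective s by move=> i j /(congr1 c); rewrite !c_s.
pose P := [pred p : {set T} * T | [&& #|p.1|.+1 == #|I|, c @: p.1 == [set~ i0],
   p.2 \notin p.1 & undominated (p.2 |: p.1)]].
have : odd #|P|.
  rewrite -sum1_card.
  have -> : \sum_(p in P) 1 =
      \sum_(Y : {set T} | (#|Y|.+1 == #|I|) && (c @: Y == [set~ i0]))
        \sum_(x | (x \notin Y) && undominated (x |: Y)) 1.
    by rewrite pair_big_dep /=; apply: eq_bigl => p; rewrite !inE !andbA.
  rewrite (bigD1 (s @: [set~ i0])) /=; last first.
    rewrite card_imset //; have := cardsC1 i0; have : 0 < #|I| by apply/card_gt0P; exists i0.
    move=> ? ->; rewrite prednK // eqxx /=; apply/eqP/setP => i.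
    apply/imsetP/idP => [[_ /imsetP[j ji ->] ->]|]; first by rewrite c_s.
    by move=> ii; exists (s i); rewrite ?c_s // imset_f.
  rewrite oddD sum1dep_card slack_door_unique /=.
  apply: odd_sum_even => Y /andP[/andP[/eqP Y1 /eqP Y2] Y3].
  by rewrite sum1dep_card; apply: door_even Y3.
(* The incidences, odd in number when counted by doors, are recounted by rooms, as pairs of a room
   and a point to remove. *)
suff : ~~ odd #|P| by move=> /negPf->.
pose h (p : {set T} * T) := (p.2 |: p.1, p.2).
pose P' := [pred q : {set T} * T | [&& #|q.1| == #|I|, undominated q.1,
   q.2 \in q.1 & c @: (q.1 :\ q.2) == [set~ i0]]].
have -> : #|P| = #|P'|.
  have hinj : {in P &, injective h}.
    move=> [Y x] [Y' x']; rewrite !inE /= => /and4P[_ _ xY _] /and4P[_ _ xY' _] [eY ex].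
    rewrite -ex in xY' eY *; congr pair.
    by rewrite -(setU1K xY) eY setU1K.
  rewrite -(card_in_imset hinj); apply: eq_card => -[X x].
  apply/imsetP/idP.
    move=> [[Y x'] /and4P[/eqP h1 h2 h3 h4] [-> ->]]; rewrite !inE /= eqxx h4 /= .
    by rewrite cardsU1 h3 /= add1n h1 eqxx setU1K.
  move=> /and4P[/eqP h1 h2 h3 h4]; exists (X :\ x, x); last by rewrite /h /= setD1K.
  have := cardsD1 x X; rewrite h3 h1 => e.
  by rewrite inE /= e add1n eqxx h4 setD11 /= setD1K.
rewrite -sum1_card.
have -> : \sum_(q in P') 1 = \sum_(X : {set T} | (#|X| == #|I|) && undominated X)
    \sum_(x | (x \in X) && (c @: (X :\ x) == [set~ i0])) 1.
  by rewrite pair_big_dep /=; apply: eq_bigl => q; rewrite !inE !andbA.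
apply: odd_sum_even => X /andP[/eqP cX dX].
rewrite sum1dep_card; apply: room_even => //; exact: nX.
Qed.

End Scarf.

(** Scarf's lemma is applied to the grid points of sum [m] together with one slack per coordinate. A
    label [k] can be missing only if its slack stands in for it, and then the cell lies near the
    face [x k = 0]. *)
Lemma sperner_cell n m (c : {ffun 'I_n.+1 -> 'I_m.+1} -> 'I_n.+1) :
  exists A : {set {ffun 'I_n.+1 -> 'I_m.+1}},
  [/\ A != set0,
      forall x, x \in A -> \sum_i x i = m,
      forall x y k, x \in A -> y \in A -> x k <= y k + n &
      forall k, (exists2 x, x \in A & c x = k) \/ (forall x, x \in A -> x k < n)].
Proof.
pose G := {t : {ffun 'I_n.+1 -> 'I_m.+1} | \sum_i t i == m}.
pose T : finType := (G + 'I_n.+1)%type.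
pose N := #|{: G}|.
(* Order i compares i-th coordinates, with ties broken by enum_rank. *)
pose r (i : 'I_n.+1) (t : T) : nat := match t with
  | inl t => (val t i * N + enum_rank t).+1
  (* Slack [i] lies below the grid in order [i], the other slacks above it; adding [j] keeps these
     distinct. *)
  | inr j => if j == i then 0 else (m.+1 * N).+1 + j end.
pose s (i : 'I_n.+1) : T := inr i.
pose c' (t : T) : 'I_n.+1 := match t with inl t => c (val t) | inr j => j end.
have rG i (t : G) : val t i * N + enum_rank t < m.+1 * N.
  have := ltn_ord (enum_rank t); have := ltn_ord (val t i); rewrite -/N; nia.
have r_inj i : injective (r i).
  move=> [t|j] [t'|j'] /=.
  - move=> [e]; congr inl; apply: enum_rank_inj; apply: val_inj => /=.
    by move: (congr1 (modn^~ N) e); rewrite !modnMDl !modn_small ?ltn_ord.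
  - by case: eqP => // _ e; have := rG i t; rewrite -ltnS e addSn ltnS ltnNge leq_addr.
  - by case: eqP => // _ e; have := rG i t'; rewrite -ltnS -e addSn ltnS ltnNge leq_addr.
  - case: eqP => [->|_]; case: eqP => [->|_] //; try lia.
    by move=> e; congr inr; apply: val_inj => /=; lia.
have s_min i t : r i (s i) <= r i t by rewrite /= eqxx.
have s_grid (t : T) : t \notin codom s -> exists g, t = inl g.
  case: t => [g|j]; first by exists g.
  by move=> /negP []; exact: codom_f.
have s_max i j t : i != j -> t \notin codom s -> r i t < r i (s j).
  move=> ij /s_grid[g ->] /=; rewrite eq_sym (negbTE ij).
  by rewrite ltnS; apply: leq_trans (rG i g) (leq_addr _ _).
have c_s i : c' (s i) = i by [].
pose f0 := [ffun i : 'I_n.+1 => if i == ord0 then @ord_max m else ord0].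
have g0P : \sum_i f0 i == m.
  rewrite big_ord_recl big1 ?addn0 => [|i _]; rewrite ffunE //=.
pose t0 : T := inl (exist (fun t : {ffun 'I_n.+1 -> 'I_m.+1} => \sum_i t i == m) f0 g0P).
have t0_grid : t0 \notin codom s by apply/negP => /codomP[].
have [X /undominatedP dX cX] := scarf r_inj s_min s_max c_s t0_grid.
pose A := [set x : {ffun 'I_n.+1 -> 'I_m.+1} | [exists g : G, (val g == x) && (inl g \in X)]].
have AP x : reflect (exists2 g : G, val g = x & inl g \in X) (x \in A).
  rewrite inE; apply: (iffP existsP) => [[g /andP[/eqP gx gX]]|[g gx gX]].
    by exists g.
  by exists g; rewrite gx eqxx.
have label k : inr k \notin X -> exists2 x, x \in A & c x = k.
  move=> kX; have : k \in c' @: X by rewrite cX.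
  move=> /imsetP[[g|j] tX kc]; last by move: kX; rewrite kc tX.
  by exists (val g) => //; apply/AP; exists g.
have A0 : A != set0.
  have [k kX] := dX t0.
  have /label[x xA _] : inr k \notin X by apply/negP => /kX /=; rewrite eqxx.
  by apply/set0Pn; exists x.
have sumA x : x \in A -> \sum_i x i = m by move=> /AP[g <- _]; apply/eqP; exact: (valP g).
(* Lowering coordinate [k] of [x] by [n] and raising the [n] others by 1 stays on the grid. The new
   point can fail to dominate [X] only in order [k], which excludes the slack of [k] and bounds that
   coordinate below on [A]. *)
have key x k : x \in A -> n <= x k ->
    inr k \notin X /\ forall y, y \in A -> x k - n <= y k.
  move=> xA nk.
  have sumx : x k + \sum_(i | i != k) x i = m by have := sumA _ xA; rewrite (bigD1 k).
  have sum1 : \sum_(i : 'I_n.+1 | i != k) 1 = n.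
    by rewrite sum1_card cardC1 card_ord.
  pose f i := if i == k then x k - n else (x i).+1.
  have sumf : \sum_i f i = m.
    rewrite (bigD1 k) //= /f eqxx (eq_bigr (fun i => x i + 1)); last first.
      by move=> i /negbTE ->; rewrite addn1.
    by rewrite big_split /= sum1 addnCA subnK // addnC.
  have fm i : f i < m.+1.
    by rewrite ltnS -sumf (bigD1 i) //= leq_addr.
  pose t := [ffun i => Ordinal (fm i)].
  have tP : \sum_i t i == m.
    by apply/eqP; apply: etrans sumf; apply: eq_bigr => i _; rewrite ffunE.
  have [i hi] := dX (inl (exist (fun t : {ffun 'I_n.+1 -> 'I_m.+1} => \sum_i t i == m) t tP)).
  have iX : inr i \notin X by apply/negP => /hi /=; rewrite eqxx.
  have tA y : y \in A -> f i <= y i.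
    move=> /AP[g <- /hi]; rewrite /= ltnS ffunE /= => h.
    rewrite leqNgt; apply/negP => lt.
    have := leq_trans (leq_addr _ _) h; apply/negP; rewrite -ltnNge.
    apply: (@leq_trans ((sval g i).+1 * N)); last exact: leq_mul.
    by rewrite mulSn addnC ltn_add2r ltn_ord.
  have ik : i = k.
    apply/eqP/contraT => ik.
    by have := tA _ xA; rewrite /f (negbTE ik) ltnn.
  rewrite -ik; split => // y /tA; by rewrite /f ik eqxx.
exists A; split => //.
  move=> x y k xA yA; have [xn|nx] := ltnP (x k) n; first by lia.
  by have [_ /(_ _ yA)] := key _ _ xA nx; lia.
move=> k; have [kX|kX] := boolP (inr k \in X); last by left; apply: label.
right=> x xA; rewrite ltnNge; apply/negP => /(key _ _ xA)[].
by rewrite kX.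
Qed.

From mathcomp Require Import all_classical all_reals all_analysis.
From mathcomp Require Import lra ring.

Import Order.TTheory GRing.Theory Num.Theory.
Import numFieldNormedType.Exports.

Local Open Scope classical_set_scope.
Local Open Scope ring_scope.

(** * The fixed point theorems of Brouwer and Schauder *)

Lemma compact_cluster_seq (R : realType) (V : normedModType R) (K : set V)
    (u : nat -> V) : compact K -> (forall n, K (u n)) ->
  exists2 l, K l & forall e, 0 < e -> forall N, exists2 n, (N <= n)%N & `|l - u n| < e.
Proof.
move=> cK uK; have [l [Kl ul]] : K `&` cluster (u @ \oo) !=set0.
  by apply: cK; exists 0%N => // n _; exact: uK.
exists l => // e e0 N.
have [] := ul (u @` [set n | (N <= n)%N]) (ball l e).
- by exists N => // n /= Nn; exists n.
- exact: nbhsx_ballx.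
by move=> _ [[n /= Nn <-]]; rewrite -ball_normE /= => lun; exists n.
Qed.

Lemma sum_continuous (R : realType) (T : topologicalType) (V : normedModType R)
    (I : Type) (s : seq I) (f : I -> T -> V) :
  (forall i, continuous (f i)) -> continuous (fun x => \sum_(i <- s) f i x).
Proof.
move=> fc x; elim: s => [|i s IH].
  by under eq_fun do rewrite big_nil; exact: cvg_cst.
by under eq_fun do rewrite big_cons; apply: cvgD => //; exact: fc.
Qed.

Section Brouwer.
Variables (R : realType) (n : nat).
Local Notation V := 'rV[R]_n.+1.

Definition simplex : set V :=
  [set v | (forall i, 0 <= v ord0 i) /\ \sum_i v ord0 i = 1].

Lemma simplex_compact : compact simplex.
Proof.
pose A := [set v : V | forall i, `[0%R, 1%R]%classic (v ord0 i)].
have cA : compact A.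
  apply: (@rV_compact R n.+1 (fun=> `[0%R, 1%R]%classic)) => _.
  exact: segment_compact.
have cl : closed [set v : V | \sum_i v ord0 i = 1].
  apply: (@preimage_closed _ _ (fun v : V => \sum_i v ord0 i) [set x | x = 1]).
    move=> v _; apply: sum_continuous => i; exact: coord_continuous.
  exact: closed_eq.
rewrite (_ : simplex = A `&` [set v : V | \sum_i v ord0 i = 1]).
  exact: compact_closedI.
apply/seteqP; split => v /= [v0 v1]; split => // i.
  by rewrite /= in_itv /= v0 /= -v1 (bigD1 i) //= lerDl sumr_ge0.
by have := v0 i; rewrite /= in_itv /= => /andP[].
Qed.

Lemma row_norm_le (v : V) (e : R) :
  0 <= e -> (forall i, `|v ord0 i| <= e) -> `|v| <= e.
Proof.
move=> e0 ve; rewrite -[`|v|]/(mx_norm v) mx_normrE; apply/bigmax_leP; split => //.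
by move=> [i j] _ /=; rewrite ord1.
Qed.

Lemma coord_norm_le (v : V) i : `|v ord0 i| <= `|v|.
Proof.
rewrite -[`|v|]/(mx_norm v) mx_normrE.
exact: (le_bigmax _ (fun ij : 'I_1 * 'I_n.+1 => `|v ij.1 ij.2|) (ord0, i)).
Qed.

(** A grid point is labelled by a coordinate that [f] does not decrease there. If a limit [v] of
    ever finer cells were not fixed, some coordinate [i] would strictly decrease near [v]. Label [i]
    would be missing there, which makes [v ord0 i] arbitrarily small, whereas it exceeds the
    nonnegative [f v ord0 i]. *)
Theorem brouwer_simplex (f : V -> V) : continuous f ->
  (forall v, simplex v -> simplex (f v)) -> exists2 v, simplex v & f v = v.
Proof.
move=> fc fS.
pose pt m (t : {ffun 'I_n.+1 -> 'I_m.+2}) : V := \row_i ((t i)%:R / m.+1%:R).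
(* The sum condition sits inside the existential so that a label is also chosen off the grid. *)
have labelP m (t : {ffun 'I_n.+1 -> 'I_m.+2}) : exists i,
    (\sum_i t i = m.+1)%N -> pt m t ord0 i <= f (pt m t) ord0 i.
  have [St|St] := eqVneq (\sum_i t i)%N m.+1; last by exists ord0 => /eqP; rewrite (negbTE St).
  have ptS : simplex (pt m t).
    split=> [i|]; first by rewrite mxE divr_ge0.
    under eq_bigr do rewrite mxE.
    by rewrite -mulr_suml -natr_sum St divff // pnatr_eq0.
  apply: contrapT => h.
  have lt i : f (pt m t) ord0 i < pt m t ord0 i.
    by rewrite ltNge; apply/negP => le; apply: h; exists i.
  have : \sum_i f (pt m t) ord0 i < \sum_i pt m t ord0 i.
    by apply: ltr_sum => //; apply/hasP; exists ord0; rewrite ?mem_index_enum.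
  by rewrite (fS _ ptS).2 ptS.2 ltxx.
pose c m t := projT1 (cid (labelP m t)).
pose A m := projT1 (cid (sperner_cell (@c m))).
have Acell m := projT2 (cid (sperner_cell (@c m))); rewrite -/(A _) in Acell.
have Ane m : exists t, t \in A m by have [/set0Pn ? _ _ _] := Acell m.
pose u m := pt m (projT1 (cid (Ane m))).
have uA m : projT1 (cid (Ane m)) \in A m by case: cid.
have SA m t : t \in A m -> simplex (pt m t).
  move=> tA; have [_ sA _ _] := Acell m.
  split=> [i|]; first by rewrite mxE divr_ge0.
  under eq_bigr do rewrite mxE.
  by rewrite -mulr_suml -natr_sum sA // divff // pnatr_eq0.
have uS m : simplex (u m) by exact: SA.
have [v Sv clv] := compact_cluster_seq simplex_compact uS.
exists v => //; apply: contrapT => fv.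
have [i lti] : exists i, f v ord0 i < v ord0 i.
  apply: contrapT => h; apply: fv; apply/rowP => i.
  have le j : v ord0 j <= f v ord0 j.
    by rewrite leNgt; apply/negP => lt; apply: h; exists j.
  have : \sum_j (f v ord0 j - v ord0 j) == 0.
    by rewrite sumrB (fS _ Sv).2 Sv.2 subrr.
  rewrite psumr_eq0 => [/allP/(_ i)|j _]; last by rewrite subr_ge0.
  by rewrite mem_index_enum subr_eq0 => /(_ isT)/eqP.
have vi0 : 0 < v ord0 i by apply: le_lt_trans lti; exact: (fS _ Sv).1.
pose g (w : V) := w ord0 i - f w ord0 i.
have cc k : continuous (fun M : V => M ord0 k) by exact: coord_continuous.
have gc : continuous g.
  move=> w; exact: (cvgB (cc i w) (continuous_comp (fc w) (cc i (f w)))).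
have /nbhs_ballP[e /= e0 eg] : nbhs v [set w | 0 < g w].
  have : 0 < g v by rewrite subr_gt0.
  by move=> /(cvgr_gt (g v) (gc v)).
(* [e / 2] keeps the cell in the ball where coordinate [i] decreases, and [v ord0 i / 2] contradicts
   smallness of that coordinate. [N] makes the cell width [n / (m + 1)] less than [d]. *)
pose d := Num.min (e / 2) (v ord0 i / 2).
have d0 : 0 < d by rewrite lt_min !divr_gt0.
pose N := (Num.truncn (n.+1%:R / d)).+1.
have [m Nm vm] := clv d d0 N.
have nd : n%:R / m.+1%:R < d.
  rewrite ltr_pdivrMr // mulrC -ltr_pdivrMr //.
  have: n%:R / d < n.+1%:R / d by rewrite ltr_pM2r ?invr_gt0 // ltr_nat.
  move/lt_trans; apply; apply: (@lt_le_trans _ _ N%:R); first exact: truncnS_gt.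
  by rewrite ler_nat leqW.
have [_ sA near lab] := Acell m.
have [[x xA cx]|small] := lab i.
  have : 0 < g (pt m x).
    apply: eg; rewrite -ball_normE /=.
    have -> : v - pt m x = (v - u m) + (u m - pt m x) by rewrite addrA subrK.
    apply: le_lt_trans (ler_normD _ _) _.
    have : `|u m - pt m x| <= n%:R / m.+1%:R.
      apply: row_norm_le => [|k]; first by rewrite divr_ge0.
      rewrite !mxE -mulrBl normrM [X in _ * X]ger0_norm ?invr_ge0 // ler_pM2r ?invr_gt0 //.
      have := near x _ k xA (uA m); have := near _ x k (uA m) xA.
      rewrite -!(ler_nat R) !natrD ler_norml => h1 h2; apply/andP; split; lra.
    have : d <= e / 2 by rewrite ge_min lexx.
    move=> de unear; have := lt_le_trans (ltr_leD vm (le_trans unear (ltW nd))) (lerD de de).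
    by rewrite -splitr.
  rewrite /g subr_gt0 ltNge -cx /c; case: cid => j /= -> //; exact: sA.
have um : u m ord0 i < d.
  apply: le_lt_trans nd; rewrite mxE ler_pM2r ?invr_gt0 // ler_nat ltnW //.
  exact: small.
have : `|(v - u m) ord0 i| < d by apply: le_lt_trans vm; exact: coord_norm_le.
have -> : (v - u m) ord0 i = v ord0 i - u m ord0 i by rewrite !mxE.
move=> /ltr_normlW vu.
have dv : d <= v ord0 i / 2 by rewrite ge_min lexx orbT.
have := lt_le_trans (ltrD vu um) (lerD dv dv).
by rewrite subrK -splitr ltxx.
Qed.

End Brouwer.

Lemma compact_net (R : realType) (E : normedModType R) (K : set E) (e : R) :
  compact K -> K !=set0 -> 0 < e ->
  exists n, exists y : 'I_n.+1 -> E, forall q, K q -> exists i, `|q - y i| < e.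
Proof.
rewrite compact_cover => cK [q0 Kq0] e0.
have [] := cK E setT (fun y => ball y e).
- by move=> y _; apply: ball_open.
- by move=> q _; exists q => //; exact: ballxx.
move=> D0 _ KD; set D := finmap.enum_fset D0.
have net q : K q -> exists i, [/\ (i < size D)%N & `|q - nth 0 D i| < e].
  move=> /KD[y /= yD]; rewrite -ball_normE /= => yq.
  by exists (index y D); rewrite index_mem [y \in D]yD nth_index // distrC.
have [i0 [i0D _]] := net _ Kq0.
exists (size D).-1, (fun i => nth 0 D i) => q /net[i [iD qi]].
have iD' : (i < (size D).-1.+1)%N by case: (size D) iD.
by exists (Ordinal iD').
Qed.

(** Schauder projection: [q] is replaced by the average of the net points [y i] with weights
    [w i q], which vanish unless [y i] is within [e] of [q]. Brouwer's theorem is applied to the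
    coefficients [s] of the combinations [S s]. *)
Lemma approx_fixed_point (R : realType) (E : normedModType R) (K : set E)
    (f : E -> E) (e : R) : compact K -> continuous f -> (forall x, K (f x)) ->
  0 < e -> exists x, `|x - f x| <= e.
Proof.
move=> cK fc fK e0.
have [|n [y ynet]] := compact_net cK _ e0; first by exists (f 0).
pose w i q : R := Num.max 0 (e - `|q - y i|).
have w0 i q : 0 <= w i q by rewrite le_max lexx.
have W0 q : K q -> 0 < \sum_i w i q.
  move=> /ynet[i qi]; rewrite (bigD1 i) //= ltr_pwDl ?sumr_ge0 //.
  by rewrite lt_max subr_gt0 qi orbT.
have wc i : continuous (w i).
  move=> q; apply: (@continuous_max _ _ (cst 0) (fun q => e - `|q - y i|)).
    exact: cvg_cst.
  apply: cvgB; first exact: cvg_cst.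
  by apply: cvg_norm; apply: cvgB; [exact: cvg_id|exact: cvg_cst].
pose S (s : 'rV[R]_n.+1) : E := \sum_i s ord0 i *: y i.
have Sc : continuous S.
  have cc i : continuous (fun v : 'rV[R]_n.+1 => v ord0 i) by exact: coord_continuous.
  apply: sum_continuous => i s; exact: (cvgZr_tmp (cc i s)).
pose g (s : 'rV[R]_n.+1) : 'rV[R]_n.+1 :=
  \row_i (w i (f (S s)) / \sum_j w j (f (S s))).
have gS s : simplex s -> simplex (g s).
  move=> _; split=> [i|]; first by rewrite mxE divr_ge0 // sumr_ge0.
  under eq_bigr do rewrite mxE.
  by rewrite -mulr_suml divff // gt_eqF // W0.
have gc : continuous g.
  have fSc : continuous (f \o S) by move=> s; apply: continuous_comp; [exact: Sc|exact: fc].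
  have wfc i : continuous (fun s => w i (f (S s))).
    by move=> s; exact: (continuous_comp (fSc s) (wc i _)).
  have gic i : continuous (fun s => w i (f (S s)) / \sum_j w j (f (S s))).
    have Wc : continuous (fun s => \sum_j w j (f (S s))) by exact: sum_continuous.
    move=> s; apply: (cvgM (wfc i s)); apply: (cvgV _ (Wc s)).
    by rewrite gt_eqF // W0.
  move=> s; have Fs : Filter (nbhs s) := nbhs_filter s.
  apply: (proj2 (@cvgrPdist_lt R _ _ (nbhs s) Fs g (g s))) => eps eps0.
  have : \forall t \near s, forall i, `|g s ord0 i - g t ord0 i| < eps / 2.
    apply: (@filter_forall _ _ (fun i t => `|g s ord0 i - g t ord0 i| < eps / 2) _ Fs) => i.
    have := proj1 (@cvgrPdist_lt R _ _ (nbhs s) Fs _ _) (gic i s) (eps / 2).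
    rewrite divr_gt0 // => /(_ isT).
    by apply: filterS => t; rewrite !mxE.
  apply: filterS => t h; apply: (@le_lt_trans _ _ (eps / 2)).
    apply: row_norm_le; first by rewrite divr_ge0 // ltW.
    by move=> i; have := ltW (h i); rewrite !mxE.
  by rewrite ltr_pdivrMr // ltr_pMr // ltr1n.
have [s Ss gs] := brouwer_simplex gc gS.
exists (S s).
have -> : S s - f (S s) = \sum_i s ord0 i *: (y i - f (S s)).
  under eq_bigr do rewrite scalerBr.
  by rewrite sumrB -scaler_suml Ss.2 scale1r.
apply: le_trans (ler_norm_sum _ _ _) _.
rewrite -[leRHS]mul1r -Ss.2 mulr_suml; apply: ler_sum => i _.
rewrite normrZ ger0_norm ?Ss.1 //.
have [le|lt] := leP (`|y i - f (S s)|) e; first by rewrite ler_wpM2l // Ss.1.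
suff -> : s ord0 i = 0 by rewrite !mul0r.
rewrite -gs mxE /w max_l ?mul0r // subr_le0 distrC; exact: ltW.
Qed.

(** The images of approximate fixed points, with errors tending to 0, cluster at some [l] in [K].
    The points themselves then also cluster at [l], and continuity concludes. *)
Theorem schauder (R : realType) (E : normedModType R) (K : set E) (f : E -> E) :
  compact K -> continuous f -> (forall x, K (f x)) -> exists x, f x = x.
Proof.
move=> cK fc fK.
have xP n : exists x, `|x - f x| <= n.+1%:R^-1.
  by apply: (approx_fixed_point cK fc fK); rewrite invr_gt0.
have [x xf] := choice xP.
have [l Kl cl] := compact_cluster_seq cK (fun n => fK (x n)).
exists l; apply: contrapT => /eqP; rewrite -subr_eq0 -normr_gt0 => d0.
set d := `|f l - l| in d0.
have /nbhs_ballP[r /= r0 rf] : nbhs l [set z | `|f l - f z| < d / 2].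
  by have /cvgrPdist_lt/(_ (d / 2)) := fc l; rewrite divr_gt0 // => /(_ isT).
have [|n Nn ln] := cl (Num.min (r / 2) (d / 2)) _ (Num.truncn (2 / r)).+1.
  by rewrite lt_min !divr_gt0.
move: ln; rewrite lt_min => /andP[ln1 ln2].
have xr : n.+1%:R^-1 < r / 2.
  rewrite -[r / 2]invrK ltf_pV2 ?posrE ?invr_gt0 ?divr_gt0 // invf_div.
  by apply: (lt_le_trans (truncnS_gt _)); rewrite ler_nat leqW.
have /rf /= : ball l r (x n).
  rewrite -ball_normE /= (_ : l - x n = (l - f (x n)) - (x n - f (x n))); last first.
    by rewrite opprB addrA subrK.
  apply: le_lt_trans (ler_normB _ _) _.
  by rewrite [ltRHS]splitr ltrD // (le_lt_trans (xf n)).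
move=> h; have : `|f l - l| < d.
  rewrite -(subrK (f (x n)) (f l)) -addrA; apply: le_lt_trans (ler_normD _ _) _.
  by rewrite [ltRHS]splitr ltrD // distrC.
by rewrite ltxx.
Qed.

(** * Connected branches of unsplit sets *)

Lemma bounded_setP (R : realType) (E : normedModType R) (A : set E) :
  bounded_set A <-> exists M, forall x, A x -> `|x| <= M.
Proof.
split=> [[M [_ MA]]|[M MA]].
  by exists (M + 1) => x Ax; apply: (MA (M + 1)) => //; rewrite ltrDl.
exists M; split; first exact: num_real.
by move=> N /ltW MN x Ax; exact: le_trans (MA _ Ax) MN.
Qed.

Lemma compact_sub_chain (T : ptopologicalType) (D : set T) (F : set (set T)) :
  compact D -> F !=set0 -> total_on F subset -> (forall A, F A -> open A) ->
  D `<=` \bigcup_(A in F) A -> exists2 A, F A & D `<=` A.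
Proof.
rewrite compact_cover => cD [A0 FA0] tF oF DF.
have [//|B BF DB] := cD _ F id oF.
have [A FA BA] : exists2 A, F A & forall X, X \in finmap.enum_fset B -> X `<=` A.
  have : forall X, X \in finmap.enum_fset B -> F X.
    by move=> X XB; have := BF X XB; rewrite inE.
  elim: (finmap.enum_fset B) => [_|X s IH h]; first by exists A0.
  have [|A FA sA] := IH; first by move=> Y Ys; apply: h; rewrite inE Ys orbT.
  have FX : F X by apply: h; rewrite inE eqxx.
  have [XA|AX] := tF _ _ FX FA.
    by exists A => // Y; rewrite inE => /orP[/eqP->|/sA].
  by exists X => // Y; rewrite inE => /orP[/eqP->//|/sA /subset_trans]; apply.
by exists A => // x /DB[X /= XB]; exact: (BA X XB).
Qed.

Section Branch.
Variables (R : realType) (E : normedModType R) (S T : set E) (p : E).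
Hypotheses (clS : closed S) (clT : closed T) (Sp : S p) (Tp : ~ T p).
Hypothesis cptS : forall B, closed B -> B `<=` S -> bounded_set B -> compact B.

(** The absence of such a bounded piece, relatively open and closed in [F], stands for a link in [F]
    from [p] to [T] or to infinity. *)
Definition splits (F : set E) := exists P Q : set E,
  [/\ closed P /\ closed Q, P `&` Q = set0, F = P `|` Q, bounded_set P &
      P p /\ P `&` T = set0].

(** This is the chain condition of Zorn's lemma, stated on complements. The bounded part of a
    splitting lies in a bounded open [W] whose closure misses the other part and [T]. The points of
    [S] on the boundary of [W] form a compact set, already removed by a single [A] of the chain, so
    that what [A] leaves of [S] splits along [W]. *)
Lemma splits_chain (F : set (set E)) :
  total_on F subset -> (forall A, F A -> open A) -> F !=set0 ->
  splits (S `\` \bigcup_(A in F) A) -> exists2 A, F A & splits (S `\` A).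
Proof.
move=> tF oF F0 [P [Q [[clP clQ] PQ SPQ /bounded_setP[r Pr] [Pp PT]]]].
have PQT : P `&` (Q `|` T) = set0 by rewrite setIUr PQ PT setU0.
have [U [V [oU oV PU QV UV]]] := proj1 (@normal_openP R E)
  (@pseudometric_normal R E) P (Q `|` T) clP (closedU clQ clT) PQT.
pose W := U `&` ball (0 : E) (r + 1).
have oW : open W by apply: openI => //; exact: ball_open.
have PW : P `<=` W.
  move=> x Px; split; first exact: PU.
  by rewrite -ball_normE /= sub0r normrN (le_lt_trans (Pr _ Px)) // ltrDl.
have clWV x : closure W x -> ~ V x.
  move=> Wx Vx; have [y [[Uy _] Vy]] := Wx V (open_nbhs_nbhs (conj oV Vx)).
  by have : (U `&` V) y by []; rewrite UV.
have bW : bounded_set (closure W).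
  apply/bounded_setP; exists (r + 2) => x Wx.
  have [y [[_ +] +]] := Wx (ball x 1) (nbhsx_ballx _ _ ltr01).
  rewrite -!ball_normE /= sub0r normrN => yr xy.
  rewrite -(subrK y x); apply: le_trans (ler_normD _ _) _; lra.
pose D := S `&` closure W `&` ~` W.
have cD : compact D.
  apply: cptS; last 1 first.
  - by apply/bounded_setP; have /bounded_setP[M MW] := bW; exists M => x [[_ /MW]].
  - apply: closedI; last exact: open_closedC.
    by apply: closedI => //; exact: closed_closure.
  - by move=> x [[]].
have [A FA DA] : exists2 A, F A & D `<=` A.
  apply: (compact_sub_chain cD F0 tF oF) => x [[Sx Wx] nWx].
  apply: contrapT => nx; have : (P `|` Q) x by rewrite -SPQ.
  by case=> [/PW|Qx] //; apply: clWV Wx _; apply: QV; left.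
exists A => //; exists ((S `\` A) `&` closure W), ((S `\` A) `&` ~` W).
have clSA : closed (S `\` A) by apply: closedI => //; exact/open_closedC/oF.
split.
- split; apply: closedI => //; [exact: closed_closure|exact: open_closedC].
- by rewrite -subset0 => x [[[Sx Ax] Wx] [_ nWx]]; apply: Ax; exact: DA.
- rewrite -setIUr; apply/esym/setIidPl => x _.
  by have [Wx|] := pselect (W x); [left; exact: subset_closure|right].
- by apply/bounded_setP; have /bounded_setP[M MW] := bW; exists M => x [_ /MW].
- split.
    have [_ Fp] : (S `\` \bigcup_(A in F) A) p by rewrite SPQ; left.
    split; last by apply: subset_closure; exact: PW.
    by split=> // Ap; apply: Fp; exists A.
  by rewrite -subset0 => x [[_ /clWV nV] Tx]; apply: nV; apply: QV; right.
Qed.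

Hypothesis nsplS : ~ splits S.

Lemma minimal_unsplit : exists M, [/\ closed M, M `<=` S, M p, ~ splits M &
  forall M', closed M' -> M' `<=` M -> M' p -> M' <> M -> splits M'].
Proof.
have [|A [[oA Ap nA] Amax]] :=
    @Zorn_bigcup _ [set A | [/\ open A, ~ A p & ~ splits (S `\` A)]].
  move=> F FP tF; split; first by apply: bigcup_open => A /FP[].
    by move=> [A /FP[]].
  have [->|/set0P F0] := eqVneq F set0; first by rewrite bigcup_set0 setD0.
  move=> /(splits_chain tF _ F0)[|A /FP[_ _ nA] //].
  by move=> A /FP[].
exists (S `\` A); split => //.
  by apply: closedI => //; exact: open_closedC.
move=> M' clM' M'S M'p M'N; apply: contrapT => nM'.
apply: (Amax (~` M')); last first.
  split; [exact: closed_openC|exact|].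
  rewrite setDE setCK (_ : S `&` M' = M') //; by apply/setIidPr => x /M'S[].
rewrite /proper; split; first by move=> x Ax /M'S[].
move=> M'A; apply: M'N; apply/seteqP; split => // x [Sx Ax].
by apply: contrapT => nx; apply: Ax; exact: M'A.
Qed.

(* Removing p and T from a minimal unsplit set leaves a connected set: a
   separation would give two smaller sets, whose splittings glue together. *)
Theorem global_branch : exists K : set E,
  [/\ K `<=` S `\` (T `|` [set p]), connected K, (S `&` closure K) p &
      ~ bounded_set (S `&` closure K) \/ exists2 q, T q & (S `&` closure K) q].
Proof.
have [M [clM MS Mp nM Mmin]] := minimal_unsplit.
pose Tp' := T `|` [set p].
have cl1 : closed [set p].
  exact/accessible_closed_set1/hausdorff_accessible/norm_hausdorff.
pose K := M `\` Tp'.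
have KM : K `<=` M by move=> x [].
have clKM : closure K `<=` M by rewrite [M](closure_id _).1 //; exact: closure_subset.
(* Otherwise [[set p]] is the bounded piece of a splitting of [M]. *)
have Kp : closure K p.
  apply: contrapT => nKp; apply: nM.
  exists [set p], (M `&` (closure K `|` T)); split.
  + split => //; apply: closedI => //; apply: closedU => //; exact: closed_closure.
  + by rewrite -subset0 => x [-> [_ []]].
  + apply/seteqP; split => [x Mx|x [->//|[]//]].
    have [->|xp] := pselect (x = p); [by left|right; split => //].
    have [Tx|nTx] := pselect (T x); [by right|left].
    by apply: subset_closure; split => // -[].
  + by apply/bounded_setP; exists `|p| => x ->.
  + by split => //; rewrite -subset0 => x [->].
exists K; split.
- by move=> x [/MS Sx nx]; split.
- apply: contrapT => /connectedPn[B [B0 KB [sB1 sB2]]].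
  have sep b : closure (B b) `&` B (~~ b) = set0.
    by case: b => //=; rewrite setIC.
  have BK b : B b `<=` K by move=> x Bx; rewrite KB; case: b Bx; [right|left].
  (* Giving [T] and [p] back to each half of the separation yields closed sets that cover [M] and
     meet only inside [Tp']. Each is proper, since it omits the other half. *)
  pose N b := M `&` (closure (B b) `|` Tp').
  have Nspl b : splits (N b).
    apply: Mmin.
    + apply: closedI => //; apply: closedU; first exact: closed_closure.
      exact: closedU.
    + by move=> x [].
    + by split=> //; right; right.
    + move=> NM; have [x Bx] := B0 (~~ b).
      have : N b x by rewrite NM; exact/KM/(BK _ _ Bx).
      case=> _ [cx|nx]; last by have [] := BK _ _ Bx.
      by have : (closure (B b) `&` B (~~ b)) x by []; rewrite sep.
  have NN b x : N b x -> N (~~ b) x -> Tp' x.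
    move=> [Mx [Bx|//]] [_ [Bx'|//]]; apply: contrapT => nx.
    have : K x by split.
    rewrite KB => Kx.
    have [c Bcx] : exists c, B c x by case: Kx; [exists false|exists true].
    have : (closure (B (~~ c)) `&` B (~~ ~~ c)) x.
      by rewrite negbK; split => //; case: (c) (b) Bx Bx' => -[].
    by rewrite sep.
  have [P0 [Q0 [[clP0 clQ0] PQ0 NPQ0 bP0 [Pp0 PT0]]]] := Nspl false.
  have [P1 [Q1 [[clP1 clQ1] PQ1 NPQ1 bP1 [Pp1 PT1]]]] := Nspl true.
  apply: nM; exists (P0 `|` P1), (Q0 `|` Q1); split.
  + by split; exact: closedU.
  (* A common point of [P] and [Q'] would lie in [T], which [P] avoids, or be [p], which is in [P']
     and hence not in [Q']. *)
  + have cross b P Q P' Q' : N b = P `|` Q -> N (~~ b) = P' `|` Q' ->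
        P `&` T = set0 -> P' `&` Q' = set0 -> P' p -> P `&` Q' = set0.
      move=> e e' PT PQ' P'p; rewrite -subset0 => x [Px Q'x].
      have : Tp' x by apply: (NN b); rewrite ?e ?e'; [left|right].
      case=> [Tx|xp]; first by have : (P `&` T) x by []; rewrite PT.
      have : (P' `&` Q') x by split=> //; rewrite xp.
      by rewrite PQ'.
    have c01 := cross false _ _ _ _ NPQ0 NPQ1 PT0 PQ1 Pp1.
    have c10 := cross true _ _ _ _ NPQ1 NPQ0 PT1 PQ0 Pp0.
    by rewrite setIUl !setIUr PQ0 PQ1 c01 c10 !setU0.
  + rewrite setUACA -NPQ0 -NPQ1 -setIUr; apply/esym/setIidPl => x Mx.
    have [nx|nx] := pselect (Tp' x); first by left; right.
    have : K x by split.
    by rewrite KB => -[Bx|Bx]; [left|right]; left; exact: subset_closure.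
  + apply/bounded_setP; move/bounded_setP: bP0 => [r0 h0]; move/bounded_setP: bP1 => [r1 h1].
    exists (Num.max r0 r1) => x [/h0|/h1] h; rewrite le_max h ?orbT //.
  + by split; [left|rewrite setIUl PT0 PT1 setU0].
- by split; [exact: MS|exact: Kp].
(* If [closure K] is bounded and misses [T], it splits [M], the other piece being the part of [M] in
   [T]. *)
- apply: contrapT => /not_orP[/contrapT bK nT]; apply: nM.
  exists (closure K), (M `&` T); split.
  + by split; [exact: closed_closure|exact: closedI].
  + rewrite -subset0 => x [Kx [Mx Tx]]; apply: nT; exists x => //.
    by split=> //; exact: MS.
  + apply/seteqP; split => [x Mx|x [/clKM//|[]//]].
    have [Tx|nTx] := pselect (T x); [by right|left].
    have [->//|xp] := pselect (x = p).
    by apply: subset_closure; split => // -[].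
  + by move: bK; rewrite (_ : S `&` closure K = closure K) //; exact/setIidPr/(subset_trans clKM).
  + split=> //; rewrite -subset0 => x [Kx Tx]; apply: nT; exists x => //.
    by split=> //; exact/MS/clKM.
Qed.

End Branch.

(** * The open mapping theorem *)

Lemma bounded_operator_continuous (R : realType) (V W : normedModType R)
    (f : {linear V -> W}) : bounded_operator f -> continuous f.
Proof.
move=> [M Mf]; apply: bounded_linear_continuous.
apply/linear_boundedP; exists M; split; first exact: num_real.
move=> N /ltW MN x; apply: le_trans (Mf x) _; exact: ler_wpM2r.
Qed.

Section OpenMapping.
Variables (R : realType) (V W : completeNormedModType R) (f : {linear V -> W}).
Hypotheses (fc : continuous f) (f_surj : forall w, exists v, f v = w).

(** Baire's theorem: by surjectivity, the closures of the images of the balls of integer radius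
    cover [W]. *)
Lemma image_closure_ball : exists n : nat, exists2 r : R, 0 < r &
  exists w0, forall w, `|w0 - w| < r -> closure (f @` [set v | `|v| <= n%:R]) w.
Proof.
pose O n := ~` closure (f @` [set v | `|v| <= n%:R]).
have [n nd] : exists n, ~ dense (O n).
  apply: contrapT => h.
  have dO : dense (\bigcap_i O i).
    apply: Baire => n; split; first exact/closed_openC/closed_closure.
    by apply: contrapT => nd; apply: h; exists n.
  have [w [_ wO]] := dO setT (ex_intro _ 0 I) openT.
  have [v fv] := f_surj w.
  apply: (wO (Num.truncn `|v|).+1 I); apply: subset_closure; exists v => //=.
  exact/ltW/truncnS_gt.
have [U [[w0 [oU Uw0]] UO]] := denseNE nd.
have /nbhs_ballP[r /= r0 rU] := open_nbhs_nbhs (conj oU Uw0).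
exists n, r => //; exists w0 => w w0w; apply: contrapT => nw.
have : (U `&` O n) w by split=> //; apply: rU; rewrite -ball_normE.
by rewrite UO.
Qed.

(** Subtracting approximate preimages of [w0 + w] and of [w0] moves the ball found by Baire's
    theorem to the origin; scaling then reaches every [w]. *)
Lemma approx_preimage : exists2 M : R, 0 <= M &
  forall w, exists v, `|v| <= M * `|w| /\ `|w - f v| <= `|w| / 2.
Proof.
have [n [r r0 [w0 w0r]]] := image_closure_ball.
have near w : closure (f @` [set v | `|v| <= n%:R]) w -> forall e, 0 < e ->
    exists2 v, `|v| <= n%:R & `|w - f v| < e.
  move=> cw e e0; have [_ [[v vn <-]]] := cw (ball w e) (nbhsx_ballx _ _ e0).
  by rewrite -ball_normE; exists v.
have near0 w : `|w| < r -> forall e, 0 < e ->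
    exists2 v, `|v| <= n%:R *+ 2 & `|w - f v| < e.
  move=> wr e e0; have e20 : 0 < e / 2 by rewrite divr_gt0.
  have [|v vn vw] := near (w0 + w) _ (e / 2) e20.
    by apply: w0r; rewrite opprD addrA subrr sub0r normrN.
  have [|v' vn' vw'] := near w0 _ (e / 2) e20.
    by apply: w0r; rewrite subrr normr0.
  exists (v - v').
    by rewrite mulr2n (le_trans (ler_normB _ _)) // lerD.
  rewrite linearB /= (_ : w - _ = (w0 + w - f v) - (w0 - f v')); last first.
    by rewrite !opprB addrCA [RHS]addrC -(addrA w0) [RHS]addrA subrK.
  by apply: le_lt_trans (ler_normB _ _) _; rewrite [ltRHS]splitr ltrD.
exists (n%:R *+ 2 * 2 / r) => [|w]; first by rewrite !mulr_ge0 // invr_ge0 ltW.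
have [->|w_neq0] := eqVneq w 0.
  by exists 0; rewrite linear0 subrr !normr0 mulr0 mul0r.
have w_gt0 : 0 < `|w| by rewrite normr_gt0.
(* Scaling by [c] gives norm [r / 2], of which the error [r / 4] is half; scaling back turns the
   bound [2 n] into the constant [4 n / r]. *)
pose c := r / 2 / `|w|.
have c0 : 0 < c by rewrite !divr_gt0.
have cw : `|c *: w| = r / 2 by rewrite normrZ gtr0_norm // divfK ?gt_eqF.
have cwr : `|c *: w| < r by rewrite cw ltr_pdivrMr // ltr_pMr // ltr1n.
have r40 : 0 < r / 4 by rewrite divr_gt0.
have [v vn vw] := near0 _ cwr _ r40.
exists (c^-1 *: v); split.
  rewrite normrZ gtr0_norm ?invr_gt0 // /c !invf_div mulrC.
  apply: le_trans (ler_wpM2r _ vn) _; first by rewrite !mulr_ge0 // ?invr_ge0 ltW.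
  by rewrite le_eqVlt; apply/orP; left; apply/eqP; field; rewrite gt_eqF.
rewrite linearZ /= -[X in X - _](scalerK (lt0r_neq0 c0)) -scalerBr normrZ.
rewrite gtr0_norm ?invr_gt0 // ler_pdivrMl //.
by apply: (le_trans (ltW vw)); rewrite /c mulrA divfK ?gt_eqF //; lra.
Qed.

(** Approximate preimages of the successive remainders are summed. The remainders halve at each
    step, so the series converges by completeness and its geometric majorant doubles the
    constant. *)
Theorem open_mapping : exists M : R, forall w, exists2 v, f v = w & `|v| <= M * `|w|.
Proof.
have [M M0 /choice[g gP]] := approx_preimage.
exists (M * 2) => w.
pose h n := iter n (fun w => w - f (g w)) w.
have hn n : `|h n| <= `|w| * 2^-1 ^+ n.
  elim: n => [|n IH]; first by rewrite expr0 mulr1.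
  rewrite /h iterS -/(h n); apply: le_trans (gP _).2 _.
  by rewrite exprSr mulrA ler_pM2r // invr_gt0.
pose u n := g (h n).
have un n : `|u n| <= geometric (M * `|w|) 2^-1 n.
  by apply: le_trans (gP _).1 _; rewrite /= -mulrA ler_wpM2l.
have half : `|2^-1 : R| < 1 by rewrite ger0_norm ?invf_lt1 // ltr1n.
have gc := @cvg_geometric_series R (M * `|w|) 2^-1 half.
have geo0 n : 0 <= geometric (M * `|w|) 2^-1 n.
  by rewrite /= !mulr_ge0 // exprn_ge0 // invr_ge0.
have uc : cvgn (series u).
  apply: normed_cvg; apply: (series_le_cvg _ geo0 un) => //.
  exact: (cvgP _ gc).
have fs n : f (series u n) = w - h n.
  elim: n => [|n IH]; first by rewrite /series /= big_geq // linear0 subrr.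
  rewrite seriesSr linearD IH (_ : h n.+1 = h n - f (u n)) //.
  by rewrite opprB addrA addrAC.
have h0 : h @ \oo --> 0.
  apply/cvgr0Pnorm_lt => e e0.
  have /cvgr0Pnorm_lt/(_ e e0) := @cvg_geometric R `|w| 2^-1 half.
  apply: filterS => n; apply: le_lt_trans.
  by rewrite ger0_norm //= mulr_ge0 // exprn_ge0 // invr_ge0.
exists (limn (series u)).
  have c1 : f (series u n) @[n --> \oo] --> f (limn (series u)).
    by apply: continuous_cvg => //; exact: fc.
  have c2 : f (series u n) @[n --> \oo] --> w.
    under eq_fun do rewrite fs.
    have : w - h n @[n --> \oo] --> w - 0 by apply: cvgB => //; exact: cvg_cst.
    by rewrite subr0.
  exact: (cvg_unique _ c1 c2).
have cl : closed [set v : V | `|v| <= M * 2 * `|w|].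
  apply: (@preimage_closed _ _ (@Num.norm R V) [set x | x <= M * 2 * `|w|]).
    by move=> x _; exact: norm_continuous.
  exact: closed_le.
apply: (closed_cvg (u_ := series u) [set v : V | `|v| <= M * 2 * `|w|] cl _ _ uc).
apply: nearW => n /=.
apply: le_trans (ler_norm_sum _ _ _) _.
apply: (@le_trans _ _ (series (geometric (M * `|w|) 2^-1) n)).
  by rewrite /series /=; apply: ler_sum => i _; exact: un.
rewrite geometric_seriesE; last by rewrite lt_eqF // ltr_normlW.
have : 0 <= (2^-1 : R) ^+ n by rewrite exprn_ge0 // invr_ge0.
have : 0 <= M * `|w| by rewrite mulr_ge0.
rewrite /= ler_pdivrMr; last by lra.
nra.
Qed.

End OpenMapping.

(** * Sets of fixed points that do not split *)

Lemma continuous_pair (T U V : topologicalType) (f : T -> U) (g : T -> V) :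
  continuous f -> continuous g -> continuous (fun x => (f x, g x)).
Proof. by move=> fc gc x; exact: (cvg_pair (fc x) (gc x)). Qed.

Lemma fst_fst_continuous (T U V : topologicalType) :
  continuous (fun q : T * U * V => q.1.1).
Proof. by move=> q; apply: (@continuous_comp _ _ _ fst fst); exact: cvg_fst. Qed.

Lemma fst_snd_continuous (T U V : topologicalType) :
  continuous (fun q : T * U * V => q.1.2).
Proof.
by move=> q; apply: (@continuous_comp _ _ _ fst snd); [exact: cvg_fst|exact: cvg_snd].
Qed.

Section Unsplit.
Variables (R : realType) (Z : normedModType R) (k : Z * R -> Z) (z0 : Z).
Hypothesis kc : continuous k.
Hypothesis kcpt : forall r : R, exists2 D : set Z, compact D &
  forall q, `|q| <= r -> D (k q).
Variable rho : R.
Hypotheses (rho0 : 0 < rho)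
  (kloc : forall z, `|z - z0| < rho -> `|k (z, 0) - z0| <= `|z - z0| / 2).

Theorem fixed_points_unsplit :
  ~ splits [set q | k q = q.1 /\ q.2 = 0 /\ q.1 <> z0] (z0, 0)
     [set q | k q = q.1].
Proof.
move=> [P [Q [[clP clQ] PQ SPQ /bounded_setP[r0 Pr0] [Pp PT]]]].
pose r := `|r0| + 1.
have r_gt0 : 0 < r by rewrite ltr_wpDl.
have Pr q : P q -> `|q| < r.
  by move=> /Pr0/le_lt_trans; apply; rewrite (le_lt_trans (ler_norm _)) // ltrDl.
have normc : continuous (fun q : (Z * R)%type => `|q|) by move=> q; exact: norm_continuous.
have fstc : continuous (fun q : (Z * R)%type => q.1) by move=> q; exact: cvg_fst.
have sndc : continuous (fun q : (Z * R)%type => q.2) by move=> q; exact: cvg_snd.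
(* [phi] will be -1 on [A]. The last part of [A] misses [P] because a point of [P] with second
   coordinate 0 can only be [(z0, 0)]. *)
pose A := Q `|` [set q | r <= `|q|] `|` [set q | q.2 = 0 /\ rho <= `|q.1 - z0|].
have clA : closed A.
  apply: closedU; first apply: closedU => //.
    apply: (@preimage_closed _ _ _ [set x : R | r <= x]); last exact: closed_ge.
    by move=> q _; exact: normc.
  apply: closedI.
    apply: (@preimage_closed _ _ (fun q : (Z * R)%type => q.2) [set x : R | x = 0]); last exact: closed_eq.
    by move=> q _; exact: sndc.
  apply: (@preimage_closed _ _ (fun q : (Z * R)%type => `|q.1 - z0|) [set x : R | rho <= x]); last exact: closed_ge.
  by move=> q _; apply: cvg_norm; apply: cvgB; [exact: fstc|exact: cvg_cst].
have AP : A `&` P = set0.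
  rewrite -subset0 => q [[[Qq|/= rq]|/= [q2 rq]] Pq].
  - by have : (P `&` Q) q by []; rewrite PQ.
  - by have := Pr _ Pq; rewrite ltNge rq.
  - have kq : k q = q.1.
      have : (P `|` Q) q by left.
      by rewrite -SPQ.
    have qz : q.1 = z0.
      apply: contrapT => qz; have : (P `&` [set q | k q = q.1 /\ q.2 = 0 /\ q.1 <> z0]) q by [].
      by rewrite PT.
    by move: rq; rewrite qz subrr normr0 leNgt rho0.
have N11 : -1 < 1 :> R by lra.
have [phi [phic phiA phiP phir]] :=
  urysohn_ext_itv (@pseudometric_normal R (Z * R)%type) clA clP AP N11.
have phi1 q : A q -> phi q = -1 by move=> Aq; apply: phiA; exists q.
have phi2 q : P q -> phi q = 1 by move=> Pq; apply: phiP; exists q.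
have phi_le q : `|phi q| <= 1.
  have := phir (phi q); rewrite /= in_itv /= ler_norml; apply; by exists q.
pose Psi (q : (Z * R)%type) : (Z * R)%type :=
  (z0 + (1 - `|phi q|) *: (k q - z0), Num.max 0 (Num.min (q.2 + phi q) r)).
have Psic : continuous Psi.
  apply: continuous_pair => q /=.
    apply: cvgD; first exact: cvg_cst.
    apply: cvgZ; last by apply: cvgB; [exact: kc|exact: cvg_cst].
    apply: cvgB; first exact: cvg_cst.
    by apply: cvg_norm; exact: phic.
  apply: (@continuous_max _ _ (cst 0) (fun q => Num.min (q.2 + phi q) r)).
    exact: cvg_cst.
  apply: (@continuous_min _ _ (fun q : (Z * R)%type => q.2 + phi q) (cst r)).
    by apply: cvgD; [exact: sndc|exact: phic].
  exact: cvg_cst.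
(* The values of [k] on the ball of radius [r] suffice: beyond it [phi = -1], and the first
   component of [Psi] is [z0]. *)
have [D cD Dk] := kcpt r.
pose comb (w : R * Z) := z0 + w.1 *: (w.2 - z0).
have combc : continuous comb.
  move=> w; apply: cvgD; first exact: cvg_cst.
  apply: cvgZ; first exact: cvg_fst.
  by apply: cvgB; [exact: cvg_snd|exact: cvg_cst].
have cDD : compact ((comb @` (`[0%R, 1%R]%classic `*` D)) `*` `[0%R, r]%classic).
  apply: compact_setX; last exact: segment_compact.
  apply: continuous_compact; first exact: continuous_subspaceT.
  by apply: compact_setX => //; exact: segment_compact.
have [q|[z t] [ez et]] := schauder cDD Psic.
  split => /=; last by rewrite in_itv /= le_max lexx /= ge_max ltW //= ge_min lexx orbT.
  have [lt|le] := leP `|q| r; last first.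
    exists (0, k 0); last by rewrite /comb /= phi1 ?normrN1 ?subrr ?scale0r //; left; right; exact: ltW.
    by split => /=; [rewrite in_itv /= lexx ler01|apply: Dk; rewrite normr0 ltW].
  exists (1 - `|phi q|, k q) => //; split => /=; last exact: Dk.
  by rewrite in_itv /= subr_ge0 phi_le /= lerBlDr lerDl.
set f := phi (z, t) in ez et.
have f1 : `|f| <= 1 by exact: phi_le.
have [f0|f0|f0] := ltgtP f 0.
(* When [phi < 0] the second coordinate can only be 0. Then [z = z0], by [kloc] near [z0] and by the
   vanishing factor elsewhere; but [phi = 1] at [(z0, 0)]. *)
- have t0 : t = 0.
    apply/eqP; rewrite eq_le -{2}et le_max lexx andbT leNgt; apply/negP => t0.
    have := et; rewrite max_r; last first.
      rewrite leNgt; apply/negP => lt0; move: et; rewrite max_l ?ltW // => t00.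
      by rewrite -t00 ltxx in t0.
    have : Num.min (t + f) r <= t + f by rewrite ge_min lexx.
    by move=> + e; rewrite e; lra.
  have zz : z = z0.
    have [lt|ge] := ltP `|z - z0| rho; last first.
      have ef : f = -1 by apply: phi1; right.
      by move: ez; rewrite ef normrN1 subrr scale0r addr0.
    apply/eqP; rewrite -subr_eq0 -normr_le0.
    have : `|z - z0| <= `|z - z0| / 2.
      rewrite -{1}ez addrC addKr normrZ; apply: le_trans _ (kloc lt).
      rewrite [in k (z, t)]t0 -/f ler_piMl // ger0_norm; last by rewrite subr_ge0.
      by rewrite gerBl.
    lra.
  have : f = 1 by apply: phi2; rewrite zz t0.
  by move=> f1'; move: f0; rewrite f1' ltr10.
(* When [phi > 0] the second coordinate is [r], which puts the point in [A]. *)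
- have tr : t = r.
    have := et; rewrite max_r => [|]; last first.
      rewrite le_min (ltW r_gt0) andbT; apply/ltW.
      apply: le_lt_trans (_ : t < _); last by rewrite ltrDl.
      by rewrite -et le_max lexx.
    rewrite /Num.min; case: ifP => // _; lra.
  have : f = -1.
    apply: phi1; left; right => /=; rewrite prod_normE /= le_max tr; apply/orP; right.
    exact: ler_norm.
  lra.
- have : (P `|` Q) (z, t).
    by rewrite -SPQ /= -[RHS]ez f0 normr0 subr0 scale1r addrC subrK.
  case=> [/phi2|Qq]; first by rewrite -/f f0; lra.
  have : f = -1 by apply: phi1; left; left.
  lra.
Qed.

End Unsplit.

(** * Reduction to a fixed point problem *)

Lemma sqr_normD (R : realType) (G : hilbertType R) (x y : G) :
  `|x + y| ^+ 2 = `|x| ^+ 2 + 2 * inner x y + `|y| ^+ 2.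
Proof.
rewrite -!inner_norm linearDl !linearDr /= (hermC _ y x) /= expr0 mul1r; ring.
Qed.

Section UnitFunctional.
Variables (R : realType) (G : hilbertType R) (e : G).
Hypothesis e1 : `|e| = 1.

Lemma inner_self : inner e e = 1.
Proof. by rewrite inner_norm e1 expr1n. Qed.

Lemma inner_unit_le x : `|inner x e| <= `|x|.
Proof.
rewrite -(@ler_pXn2r _ 2) ?nnegrE // -normrX ger0_norm ?sqr_ge0 //.
have : 0 <= `|x + - inner x e *: e| ^+ 2 by rewrite exprn_ge0.
rewrite sqr_normD linearZr_LR /= normrZ e1 mulr1 normrN -normrX ger0_norm ?sqr_ge0 //.
rewrite expr2; lra.
Qed.

Lemma inner_unit_continuous : continuous (fun x : G => inner x e).
Proof.
move=> x; apply/cvgrPdist_lt => eps eps0; near=> y.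
rewrite -linearBl /=; apply: le_lt_trans (inner_unit_le _) _.
near: y; exact: cvgr_dist_lt.
Unshelve. all: by end_near. Qed.

End UnitFunctional.

Lemma precompact_image_closure (V W : topologicalType) (f : V -> W) (A : set V) :
  precompact (f @` A) -> exists2 D : set W, compact D & forall x, A x -> D (f x).
Proof.
rewrite precompactE => cD; exists (closure (f @` A)) => // x Ax.
by apply: subset_closure; exists x.
Qed.

(** * Extension of the nonlinear map from the sphere to the whole space *)

Section Radial.
Variables (R : realType) (V W : normedModType R) (N : V -> W) (e : V).
Hypotheses (e1 : `|e| = 1) (Nc : {within sphere, continuous N})
  (Ncpt : precompact (N @` sphere)).

(** The extension homogeneous of degree 1. Away from 0 it uses [N] on the sphere only; at 0 the norm
    factor vanishes, and boundedness of [N] on the sphere gives continuity. *)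
Definition radial x := `|x| *: N (`|x|^-1 *: x).

Lemma radial_sphere x : `|x| = 1 -> radial x = N x.
Proof. by move=> x1; rewrite /radial x1 invr1 !scale1r. Qed.

Lemma normalized_sphere x : x != 0 -> @sphere R V (`|x|^-1 *: x).
Proof.
by move=> x0; rewrite /sphere /= normrZ normfV normr_id mulVf // normr_eq0.
Qed.

Lemma radial_compact r : exists2 D : set W, compact D &
  forall x, `|x| <= r -> D (radial x).
Proof.
have [D0 cD0 ND0] := precompact_image_closure Ncpt.
pose sc (w : R * W) := w.1 *: w.2.
have scc : continuous sc by move=> w; apply: cvgZ; [exact: cvg_fst|exact: cvg_snd].
exists (sc @` (`[0%R, r]%classic `*` D0)).
  apply: continuous_compact; first exact: continuous_subspaceT.
  by apply: compact_setX => //; exact: segment_compact.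
move=> x xr; have [x0|x0] := eqVneq x 0.
  exists (0, N e); last by rewrite /sc /radial /= x0 normr0 !scale0r.
  split=> /=; last exact: ND0.
  by rewrite in_itv /= lexx (le_trans _ xr).
exists (`|x|, N (`|x|^-1 *: x)) => //; split=> /=; first by rewrite in_itv /= normr_ge0.
exact/ND0/normalized_sphere.
Qed.

Lemma radial_continuous : continuous radial.
Proof.
have [D cD ND] := precompact_image_closure Ncpt.
have /bounded_setP[M MD] := compact_bounded cD.
move=> x; have [->|x0] := eqVneq x 0.
  have r0 : radial 0 = 0 by rewrite /radial normr0 scale0r.
  rewrite /continuous_at r0; apply/cvgr0Pnorm_lt => eps eps0.
  have M0 : 0 <= M by exact: le_trans (normr_ge0 (N e)) (MD _ (ND _ e1)).
  have /cvgr0Pnorm_lt/(_ (eps / (M + 1))) : id x @[x --> (0 : V)] --> (0 : V) by exact: cvg_id.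
  rewrite divr_gt0 ?ltr_wpDl // => /(_ isT); apply: filterS => y.
  have [->|y0] := eqVneq y 0; first by rewrite r0 !normr0.
  rewrite ltr_pdivlMr ?ltr_wpDl // => yM; rewrite normrZ normr_id.
  apply: le_lt_trans yM; rewrite ler_wpM2l //.
  apply: le_trans (MD _ (ND _ (normalized_sphere y0))) _; by rewrite lerDl.
have pc : `|y|^-1 *: y @[y --> x] --> `|x|^-1 *: x.
  apply: cvgZ; last exact: cvg_id.
  by apply: cvgV; [rewrite normr_eq0|exact: norm_continuous].
apply: cvgZ; first exact: norm_continuous.
have Nx := (subspace_continuousP _ _).1 Nc _ (normalized_sphere x0).
move=> U /Nx NU; have /pc := NU; rewrite /nbhs /= /fmap /=.
have xn0 : \forall y \near x, y != 0.
  have : \forall y \near x, 0 < `|y|.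
    by apply: (cvgr_gt _ (@norm_continuous _ V x)); rewrite normr_gt0.
  by apply: filterS => y; rewrite normr_gt0.
by apply: filterS2 xn0 => y y0; apply; exact: normalized_sphere.
Qed.

End Radial.

(** * The bordered operator and its bounded inverse *)

Section Bordered.
Variables (R : realType) (G H : hilbertType R) (L C : {linear G -> H}).
Variables (xs : G) (ls : R).
Hypotheses (bndL : bounded_operator L) (bndC : bounded_operator C).
Hypotheses (xs1 : `|xs| = 1) (Cxs : C xs != 0).
Let A x := L x - ls *: C x.
Hypothesis kerA : Defs.kernel A = range (fun t : R => t *: xs).
Hypothesis dsA : direct_sum (range A) (C @` Defs.kernel A).

Definition bordered x := L x - ls *: C x + inner x xs *: C xs.

Lemma bordered_linear : linear bordered.
Proof.
move=> a x y; rewrite /bordered !linearP linearPl /= scalerDl.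
by rewrite (addrACA (a *: L x)) (addrACA (a *: L x + _)) 2!scalerDr scalerA.
Qed.

Lemma eigenvector : A xs = 0.
Proof.
have : Defs.kernel A xs by rewrite kerA; exists 1 => //; rewrite scale1r.
by [].
Qed.

Lemma bordered_eigenvector : bordered xs = C xs.
Proof. by rewrite /bordered [_ - _]eigenvector add0r inner_self // scale1r. Qed.

(** If the operator kills [h], then [A h] is a multiple of [C xs], hence in the intersection of the
    two summands, which is 0. So [h] is both orthogonal to [xs] and a multiple of it. *)
Lemma bordered_inj : injective bordered.
Proof.
pose f : {linear G -> H} := HB.pack bordered (GRing.isLinear.Build _ _ _ _ _ bordered_linear).
move=> x y /eqP; rewrite -subr_eq0 -[bordered x - _](linearB f) /= => /eqP.
rewrite /bordered -/(A (x - y)) => e; apply/eqP; rewrite -subr_eq0; apply/eqP.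
set h := x - y in e *.
have Ah : A h = - inner h xs *: C xs by apply/eqP; rewrite scaleNr -addr_eq0 e.
have A0 : A h = 0.
  have : (range A `&` C @` Defs.kernel A) (A h).
    split; first by exists h.
    exists (- inner h xs *: xs); last by rewrite linearZ.
    by rewrite kerA; exists (- inner h xs).
  by rewrite dsA.2.
have i0 : inner h xs = 0.
  move/eqP: Ah; rewrite A0 eq_sym scaler_eq0 (negbTE Cxs) orbF oppr_eq0.
  by move/eqP.
have : Defs.kernel A h by [].
by rewrite kerA => -[t _ th]; move: i0; rewrite -th linearZl_LR /= inner_self // mulr1 => ->; rewrite scale0r.
Qed.

Lemma bordered_surj h : exists x, bordered x = h.
Proof.
have [_ [_ [[y _ <-] [z + <-] ->]]] := dsA.1 h.
rewrite kerA => -[t _ <-].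
(* The given vector is [A y + t C xs]. The operator adds [<y, xs> C xs] to [A y] and sends [xs] to
   [C xs], whence the coefficient. *)
exists (y + (t - inner y xs) *: xs).
rewrite addrC bordered_linear bordered_eigenvector /bordered addrC -addrA -scalerDl.
have -> : C (t *: xs) = t *: C xs by rewrite linearZ.
by rewrite [inner y xs + _]addrC subrK.
Qed.

Lemma bordered_inverse : exists (Bi : H -> G) (M : R),
  [/\ 0 <= M, cancel bordered Bi, cancel Bi bordered,
      {morph Bi : h h' / h - h'} & forall h, `|Bi h| <= M * `|h|].
Proof.
pose f : {linear G -> H} := HB.pack bordered (GRing.isLinear.Build _ _ _ _ _ bordered_linear).
have fc : continuous f.
  move=> x; apply: cvgD.
    apply: cvgB; first exact: bounded_operator_continuous.
    by apply: cvgZl_tmp; exact: bounded_operator_continuous.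
  apply: cvgZr_tmp; exact: inner_unit_continuous.
have [M fM] := open_mapping fc bordered_surj.
have [Bi BiP] := choice (fun h => (let: ex_intro2 v a b := fM h in
   ex_intro (fun v => f v = h /\ `|v| <= M * `|h|) v (conj a b))).
have BiK : cancel Bi bordered by move=> h; exact: (BiP h).1.
exists Bi, `|M|; split => //.
- by move=> x; apply: bordered_inj; rewrite BiK.
- move=> h h'; apply: bordered_inj; rewrite BiK.
  by rewrite -[bordered]/(f : G -> H) linearB /= !BiK.
- by move=> h; apply: le_trans (BiP h).2 _; rewrite ler_wpM2r // ler_norm.
Qed.

End Bordered.

(** * The compact fixed point map and its fixed points *)

Section Reduction.
Variables (R : realType) (G H : hilbertType R) (L C : {linear G -> H}) (N : G -> H).
Variables (xs : G) (ls : R) (Bi : H -> G) (M : R).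
Hypotheses (bndC : bounded_operator C) (contN : {within sphere, continuous N})
  (cptN : compact_map sphere N) (cptC : compact_map setT C).
Hypotheses (xs1 : `|xs| = 1) (Bxs : bordered L C xs ls xs = C xs).
Hypotheses (M0 : 0 <= M) (bK : cancel (bordered L C xs ls) Bi)
  (BiK : cancel Bi (bordered L C xs ls))
  (BiB : {morph Bi : h h' / h - h'}) (BiM : forall h, `|Bi h| <= M * `|h|).

Let c x := Bi (C x).
Let n x := Bi (radial N x).

(** The triple is ordered [(x, l, e)], unlike in [solutions]. Applying [Bi] turns the equation into
    [x = <x, xs> xs + correction (x, l, e)]. *)
Definition correction (q : G * R * R) : G :=
  (q.1.2 - ls) *: c q.1.1 - q.2 *: n q.1.1.

(** For [w = (a, l, k)], the component of [k] along [xs] is replaced by [a] and subtracted from [l].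
    As this map is continuous, compactness has to be checked on its arguments only. *)
Definition assemble (w : R * R * G) : G * R :=
  (w.1.1 *: xs + w.2 - inner w.2 xs *: xs, w.1.2 - inner w.2 xs).

(* Preconditioning x - <x, xs> xs - correction = 0, |x|^2 - 1 = 0 by the inverse
   of its derivative at (xs, ls) gives this fixed point problem, whose
   linearization at (xs, ls) vanishes for q.2 = 0. *)
Definition fixed_point_map (q : G * R * R) : G * R :=
  assemble (inner q.1.1 xs - (`|q.1.1| ^+ 2 - 1) / 2, q.1.2, correction q).

Lemma Bi_continuous : continuous Bi.
Proof.
move=> h; apply/cvgrPdist_lt => e e0; near=> h'.
rewrite -BiB; apply: le_lt_trans (BiM _) _.
apply: (@le_lt_trans _ _ ((M + 1) * `|h - h'|)).
  by rewrite ler_wpM2r // lerDl.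
rewrite mulrC -ltr_pdivlMr ?ltr_wpDl //.
by near: h'; apply: cvgr_dist_lt => //; rewrite divr_gt0 // ltr_wpDl.
Unshelve. all: by end_near. Qed.

Lemma c_continuous : continuous c.
Proof.
have Cc := bounded_operator_continuous bndC.
by move=> x; apply: (@continuous_comp _ _ _ C Bi); [exact: Cc|exact: Bi_continuous].
Qed.

Lemma sphere_bounded : bounded_set (sphere : set G).
Proof. by apply/bounded_setP; exists 1 => x ->. Qed.

Lemma N_precompact : precompact (N @` sphere).
Proof. by apply: cptN.2 => //; exact: sphere_bounded. Qed.

Lemma n_continuous : continuous n.
Proof.
have Nc := radial_continuous xs1 contN N_precompact.
by move=> x; apply: (@continuous_comp _ _ _ (radial N) Bi); [exact: Nc|exact: Bi_continuous].
Qed.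

Lemma correction_continuous : continuous correction.
Proof.
have f1 : continuous (fun q : G * R * R => q.1.1) by exact: fst_fst_continuous.
have f2 : continuous (fun q : G * R * R => q.1.2) by exact: fst_snd_continuous.
move=> q; apply: cvgB; apply: cvgZ.
- by apply: cvgB; [exact: f2|exact: cvg_cst].
- by apply: (continuous_comp (f1 q)); exact: c_continuous.
- exact: cvg_snd.
- by apply: (continuous_comp (f1 q)); exact: n_continuous.
Qed.

Lemma assemble_continuous : continuous assemble.
Proof.
have f1 : continuous (fun q : R * R * G => q.1.1) by exact: fst_fst_continuous.
have f2 : continuous (fun q : R * R * G => q.1.2) by exact: fst_snd_continuous.
have f3 : continuous (fun q : R * R * G => inner q.2 xs).
  move=> q; apply: (@continuous_comp _ _ _ snd (fun x => inner x xs)); first exact: cvg_snd.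
  exact: inner_unit_continuous.
apply: continuous_pair => q.
  apply: cvgB; last by apply: cvgZr_tmp; exact: f3.
  by apply: cvgD; [apply: cvgZr_tmp; exact: f1|exact: cvg_snd].
by apply: cvgB; [exact: f2|exact: f3].
Qed.

Lemma fixed_point_map_continuous : continuous fixed_point_map.
Proof.
have f1 : continuous (fun q : G * R * R => q.1.1) by exact: fst_fst_continuous.
have f2 : continuous (fun q : G * R * R => q.1.2) by exact: fst_snd_continuous.
pose arg (q : G * R * R) := (inner q.1.1 xs - (`|q.1.1| ^+ 2 - 1) / 2, q.1.2, correction q).
have argc : continuous arg.
  apply: continuous_pair; last exact: correction_continuous.
  apply: continuous_pair; last exact: f2.
  move=> q; apply: cvgB.
    apply: (@continuous_comp _ _ _ (fun q : G * R * R => q.1.1) (fun x => inner x xs)).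
      exact: f1.
    exact: inner_unit_continuous.
  apply: cvgMr_tmp; apply: cvgB; last exact: cvg_cst.
  have nq : `|q0.1.1| @[q0 --> q] --> `|q.1.1|.
    by apply: (@continuous_comp _ _ _ (fun q : G * R * R => q.1.1) Num.norm); [exact: f1|exact: norm_continuous].
  exact: (cvgM nq nq).
by move=> q; apply: (@continuous_comp _ _ _ arg assemble); [exact: argc|exact: assemble_continuous].
Qed.

Lemma fixed_point_map_compact r : exists2 D : set (G * R), compact D &
  forall q : G * R * R, `|q| <= r -> D (fixed_point_map q).
Proof.
have [DN cDN DNP] := radial_compact xs1 N_precompact r.
have bB : bounded_set [set x : G | `|x| <= r] by apply/bounded_setP; exists r.
have [DC cDC DCP] := precompact_image_closure (cptC.2 _ (@subsetT _ _) bB).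
pose I b : set R := `[- b, b]%classic.
have cI b : compact (I b) by exact: segment_compact.
have IP b x : `|x| <= b -> I b x by rewrite ler_norml /I /= in_itv.
pose comb (w : (R * H) * (R * H)) := w.1.1 *: Bi w.1.2 - w.2.1 *: Bi w.2.2.
have combc : continuous comb.
  have scB : continuous (fun w : R * H => w.1 *: Bi w.2).
    move=> w; apply: cvgZ; first exact: cvg_fst.
    by apply: (@continuous_comp _ _ _ snd Bi); [exact: cvg_snd|exact: Bi_continuous].
  move=> w; apply: cvgB.
    by apply: (@continuous_comp _ _ _ fst (fun w : R * H => w.1 *: Bi w.2)); [exact: cvg_fst|exact: scB].
  by apply: (@continuous_comp _ _ _ snd (fun w : R * H => w.1 *: Bi w.2)); [exact: cvg_snd|exact: scB].
(* [r] bounds [<x, xs>] and [(r ^+ 2 + 1) / 2] bounds the normalization term. *)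
pose D := assemble @` ((I (r + (r ^+ 2 + 1) / 2) `*` I r) `*`
  (comb @` ((I (r + `|ls|) `*` DC) `*` (I r `*` DN)))).
exists D.
  apply: continuous_compact; first exact/continuous_subspaceT/assemble_continuous.
  apply: compact_setX; first exact: compact_setX.
  apply: continuous_compact; first exact: continuous_subspaceT.
  by apply: compact_setX; exact: compact_setX.
move=> [[x l] e] /=; rewrite !prod_normE /= !ge_max => /andP[/andP[xr lr] er].
exists (inner x xs - (`|x| ^+ 2 - 1) / 2, l, correction (x, l, e)) => //.
split; first split => /=.
- apply: IP; apply: le_trans (ler_normB _ _) _; apply: lerD.
    exact: le_trans (inner_unit_le xs1 _) xr.
  rewrite normrM [`|2^-1|]ger0_norm ?invr_ge0 // ler_pM2r ?invr_gt0 //.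
  apply: le_trans (ler_normB _ _) _; rewrite normr1 lerD2r normrX normr_id.
  by rewrite lerXn2r // nnegrE // (le_trans _ xr).
- exact: IP.
exists ((l - ls, C x), (e, radial N x)) => //.
split; split => /=.
- by apply: IP; apply: le_trans (ler_normB _ _) _; rewrite lerD2r.
- exact: DCP.
- exact: IP.
- exact: DNP.
Qed.

(** At a fixed point, the second component says that [k] is orthogonal to [xs]. Pairing the first
    one with [xs] then shows that [x] has norm 1, after which it reads [x = <x, xs> xs + k], the
    equation seen through the bordered operator. *)
Lemma fixed_point_solution (x : G) (l e : R) :
  fixed_point_map (x, l, e) = (x, l) <-> solutions L C N (x, e, l).
Proof.
set k := correction (x, l, e).
have BD u v : bordered L C xs ls (u + v) = bordered L C xs ls u + bordered L C xs ls v.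
  by have := bordered_linear L C xs ls 1 u v; rewrite !scale1r.
have BZ a u : bordered L C xs ls (a *: u) = a *: bordered L C xs ls u.
  have B0 : bordered L C xs ls 0 = 0
    by apply: (addrI (bordered L C xs ls 0)); rewrite -BD !addr0.
  by have := bordered_linear L C xs ls a u 0; rewrite !addr0 B0 addr0.
have Bk : bordered L C xs ls k = (l - ls) *: C x - e *: radial N x.
  by rewrite /k /correction /= -scaleNr BD !BZ /c /n !BiK scaleNr.
have eqB : bordered L C xs ls x = bordered L C xs ls (inner x xs *: xs + k) <->
    L x + e *: radial N x = l *: C x.
  rewrite BD BZ Bxs Bk /bordered addrC scalerBl -!addrA (addrCA (l *: C x)) [L x + _]addrC.
  split=> [/addrI/addrI ->|e1]; first by rewrite subrK.
  by congr (_ + (_ + _)); rewrite -e1 addrK.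
rewrite /fixed_point_map /assemble /= -/k; split=> [[ex el]|[x1 ex]].
  have ik : inner k xs = 0 by move/eqP: el; rewrite subr_eq addrC -subr_eq subrr eq_sym => /eqP.
  move: ex; rewrite ik scale0r subr0 => ex.
  have x1 : `|x| = 1.
    have : inner x xs = inner x xs - (`|x| ^+ 2 - 1) / 2.
      by rewrite -{1}ex linearDl linearZl_LR /= ik inner_self // mulr1 addr0.
    move=> h; apply/eqP; rewrite -sqrp_eq1 //; apply/eqP; lra.
  split=> //=; rewrite -(radial_sphere N x1); apply/eqB.
  by congr (bordered _ _ _ _ _); rewrite -{1}ex x1 expr1n subrr mul0r subr0.
move: x1 ex => /= x1; rewrite -(radial_sphere N x1) => /eqB /(can_inj bK) ex.
have ik : inner k xs = 0.
  have := congr1 (fun u => inner u xs) ex.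
  by rewrite linearDl linearZl_LR /= inner_self // mulr1 => h; lra.
by rewrite ik x1 expr1n subrr mul0r !subr0 scale0r subr0 -ex.
Qed.

(** With [d] the distance to [(xs, ls)] and [m] a bound for [c], the first-order terms cancel. The
    remainders are at most [d^2 / 2 + 2 m d^2] and [m d^2], hence at most [d / 2] once
    [d (1 + 4 m) <= 1]. *)
Lemma fixed_point_local : exists2 rho : R, 0 < rho & forall z : G * R,
  `|z - (xs, ls)| < rho ->
  `|fixed_point_map (z, 0) - (xs, ls)| <= `|z - (xs, ls)| / 2.
Proof.
have [MC MCP] := bndC.
pose m := M * `|MC|.
have m0 : 0 <= m by rewrite mulr_ge0.
have cm h : `|c h| <= m * `|h|.
  apply: le_trans (BiM _) _; rewrite -mulrA ler_wpM2l //.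
  by apply: le_trans (MCP _) _; rewrite ler_wpM2r // ler_norm.
have cxs : c xs = xs by rewrite /c -Bxs bK.
exists (1 + 4 * m)^-1 => [|[x l] zr]; first by rewrite invr_gt0 ltr_wpDr // mulr_ge0.
set d := `|_| in zr *.
have := erefl d; rewrite {1}/d prod_normE /= => ed.
pose h := x - xs; pose mu := l - ls.
have hd : `|h| <= d by rewrite -ed le_max lexx.
have mud : `|mu| <= d by rewrite -ed le_max lexx orbT.
have d0 : 0 <= d by rewrite /d.
have xh : x = xs + h by rewrite /h addrC subrK.
have cx : c x = xs + c h.
  have -> : c h = c x - c xs by rewrite /c /h linearB /= BiB.
  by rewrite cxs addrC subrK.
have tch : `|inner (c h) xs| <= m * d.
  by apply: le_trans (inner_unit_le xs1 _) _; apply: le_trans (cm _) _; rewrite ler_wpM2l.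
have chd : `|c h| <= m * d by apply: le_trans (cm _) _; rewrite ler_wpM2l.
have bx : inner x xs - (`|x| ^+ 2 - 1) / 2 = 1 - `|h| ^+ 2 / 2.
  rewrite xh sqr_normD xs1 expr1n linearDl /= inner_self // (hermC _ xs h) /= expr0 mul1r.
  lra.
have kE : correction (x, l, 0) = mu *: (xs + c h) by rewrite /correction /= scale0r subr0 cx.
have ikE : inner (correction (x, l, 0)) xs = mu + mu * inner (c h) xs.
  have e : inner (xs + c h) xs = 1 + inner (c h) xs by rewrite linearDl /= inner_self.
  by rewrite kE linearZl_LR /= e mulrDr mulr1.
have d2 : d ^+ 2 * (1 + 4 * m) <= d.
  rewrite expr2 -mulrA ler_piMr // -ler_pdivlMr ?ltr_wpDr ?mulr_ge0 // mul1r; exact: ltW.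
have mudm : `|mu| * (m * d) <= m * d ^+ 2.
  by rewrite expr2 mulrCA ler_wpM2l // ler_wpM2r.
rewrite /fixed_point_map /assemble /= bx ikE prod_normE /= ge_max; apply/andP; split.
  rewrite kE.
  have E (b u i : R) (w : G) : (1 - b) *: xs + u *: (xs + w) - (u + u * i) *: xs - xs
      = - b *: xs + u *: (w - i *: xs).
    rewrite scalerBl scale1r scaleNr scalerDr scalerDl scalerBr scalerA.
    rewrite -[X in X - xs]addrA opprD [X in _ + X - xs]addrACA subrr add0r.
    by rewrite addrAC [X in X + _]addrAC subrr add0r.
  rewrite E.
  apply: le_trans (ler_normD _ _) _; rewrite !normrZ xs1 mulr1 normrN (@ger0_norm _ (`|h| ^+ 2 / 2)) ?divr_ge0 //.
  have : `|c h - inner (c h) xs *: xs| <= m * d *+ 2.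
    by apply: le_trans (ler_normB _ _) _; rewrite normrZ xs1 mulr1 mulr2n lerD.
  move=> /(ler_wpM2l (normr_ge0 mu)) h1.
  have h2 : `|h| ^+ 2 <= d ^+ 2 by rewrite lerXn2r ?nnegrE.
  move: h1 d2 mudm h2; rewrite mulr2n mulrDr; lra.
have -> : l - (mu + mu * inner (c h) xs) - ls = - (mu * inner (c h) xs) by rewrite /mu; ring.
rewrite normrN normrM.
have := ler_wpM2l (normr_ge0 mu) tch; move: d2 mudm; have := exprn_ge0 2 d0; have := mulr_ge0 m0 (exprn_ge0 2 d0); lra.
Qed.

End Reduction.

(** * From the fixed points back to the solutions *)

Theorem theorem3p10 (R : realType) (G H : hilbertType R)
  (sepG : separable G) (sepH : separable H)
  (L C : {linear G -> H}) (N : G -> H)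
  (bndL : bounded_operator L) (bndC : bounded_operator C)
  (contN : {within sphere, continuous N})
  (cptN : compact_map sphere N) (cptC : compact_map setT C)
  (xs : G) (ls : R)
  (simple : simple_solution L C N (xs, 0, ls)) :
  let Sigma := solutions L C N in
  let Sigma0 := trivial_solutions L C N in
  exists K : set (G * R * R),
    [/\ K `<=` Sigma `\` Sigma0,
        connected K,
        (Sigma `&` closure K) (xs, 0, ls) &
        ~ bounded_set (Sigma `&` closure K) \/
        exists q, [/\ Sigma0 q, q != (xs, 0, ls) & (Sigma `&` closure K) q]].
Proof.
move=> Sigma Sigma0.
have [[[xs1 Lxs] _] kerA Cxs dsA] := simple.
move: xs1 Lxs kerA Cxs dsA => /= xs1 Lxs kerA Cxs dsA.
have [Bi [M [M0 bK BiK BiB BiM]]] := bordered_inverse bndL bndC xs1 Cxs kerA dsA.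
have Bxs := bordered_eigenvector xs1 kerA.
pose k := fixed_point_map C N xs ls Bi.
have kc : continuous k by exact: (fixed_point_map_continuous bndC contN cptN xs1 M0 BiB BiM).
have kcpt := fixed_point_map_compact ls cptN cptC xs1 M0 BiB BiM.
have [rho rho0 kloc] := fixed_point_local N bndC xs1 Bxs M0 bK BiB BiM.
have ksol x l e : k (x, l, e) = (x, l) <-> Sigma (x, e, l).
  exact: (fixed_point_solution N xs1 Bxs bK BiK).
(* [sw] passes between the order [(x, e, l)] of the solutions and the order [(x, l, e)] of the
   arguments of [k]. *)
pose sw (p : G * R * R) : G * R * R := (p.1.1, p.2, p.1.2).
have f1 : continuous (fun q : G * R * R => q.1.1) by exact: fst_fst_continuous.
have f2 : continuous (fun q : G * R * R => q.1.2) by exact: fst_snd_continuous.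
have f3 : continuous (fun q : G * R * R => q.2) by move=> q; exact: cvg_snd.
have swc : continuous sw.
  by apply: continuous_pair => //; apply: continuous_pair.
have swK : involutive sw by move=> [[x e] l].
have swn p : `|sw p| = `|p|.
  by rewrite /sw !prod_normE /= -!maxA (maxC `|p.2|).
have SigmaE p : Sigma p <-> k (sw p) = (sw p).1.
  by case: p => [[x e] l]; rewrite -ksol.
have clSigma : closed Sigma.
  have -> : Sigma = (fun p => `|k (sw p) - (sw p).1|) @^-1` [set x : R | x = 0].
    apply/seteqP; split => p; rewrite SigmaE /=.
      by move=> ->; rewrite subrr normr0.
    by move=> /eqP; rewrite normr_eq0 subr_eq0 => /eqP.
  apply: preimage_closed; last exact: closed_eq.
  move=> p _; apply: cvg_norm; apply: cvgB.
    by apply: (@continuous_comp _ _ _ sw k); [exact: swc|exact: kc].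
  by apply: (@continuous_comp _ _ _ sw fst); [exact: swc|exact: cvg_fst].
(* The other trivial solutions form a closed set because, by [kloc], none is within [rho] of
   [(xs, 0, ls)]. *)
pose T := Sigma0 `\ (xs, 0, ls).
have isolated x l : Sigma (x, 0, l) -> `|((x, l) : G * R) - (xs, ls)| < rho -> (x, l) = (xs, ls).
  move=> /ksol kx xl; apply/eqP; rewrite -subr_eq0 -normr_le0.
  by have := kloc _ xl; rewrite -/k kx; lra.
have clT : closed T.
  have -> : T = Sigma `&` [set p | p.1.2 = 0] `&`
      [set p | rho <= `|((p.1.1, p.2) : G * R) - (xs, ls)|].
    apply/seteqP; split => -[[x e] l] /=.
      move=> [[Sp /= e0] np]; split=> //; rewrite leNgt; apply/negP => lt.
      by apply: np; rewrite /= e0 in Sp *; have [-> ->] := isolated _ _ Sp lt.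
    move=> [[Sp /= e0] ge]; split=> // -[ex _ el].
    by move: ge; rewrite ex el subrr normr0 leNgt rho0.
  apply: closedI; first apply: closedI => //.
    apply: (@preimage_closed _ _ (fun p : G * R * R => p.1.2) [set x : R | x = 0]); last exact: closed_eq.
    by move=> p _; exact: f2.
  apply: (@preimage_closed _ _ (fun p : G * R * R => `|((p.1.1, p.2) : G * R) - (xs, ls)|)
    [set x : R | rho <= x]); last exact: closed_ge.
  move=> p _; apply: cvg_norm; apply: cvgB; last exact: cvg_cst.
  exact: (continuous_pair f1 f3).
have Tp : ~ T (xs, 0, ls) by move=> [_ np]; exact: np.
have Sp : Sigma (xs, 0, ls) by case: simple => -[].
(* The pair [(x, l)] of a solution is a value of [k], so on a bounded set it stays in a compact set,
   while [e] stays in a segment. *)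
have cptS B : closed B -> B `<=` Sigma -> bounded_set B -> compact B.
  move=> clB BS /bounded_setP[r Br]; have [D cD kD] := kcpt r.
  apply: (@subclosed_compact _ _ (sw @` (D `*` `[- r, r]%classic))) => //.
    apply: continuous_compact; first exact: continuous_subspaceT.
    by apply: compact_setX => //; exact: segment_compact.
  move=> p Bp; exists (sw p); last exact: swK.
  have pr := Br _ Bp; split => /=.
    by have /SigmaE := BS _ Bp; rewrite /sw /= => <-; apply: kD; rewrite -[(_, _)]/(sw p) swn.
  rewrite in_itv /= -ler_norml; apply: le_trans pr.
  by rewrite prod_normE /= le_max prod_normE le_max lexx orbT.
have nspl : ~ splits T (xs, 0, ls) Sigma.
  move=> [P [Q [[clP clQ] PQ SPQ /bounded_setP[r Pr] [Pp PT]]]].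
  apply: (fixed_points_unsplit kc kcpt rho0 kloc).
  have clsw F : closed F -> closed (sw @^-1` F).
    by move=> clF; apply: preimage_closed => // q _; exact: swc.
  exists (sw @^-1` P), (sw @^-1` Q); split.
  - by split; exact: clsw.
  - by rewrite -preimage_setI PQ preimage_set0.
  - by rewrite -preimage_setU -SPQ; apply/seteqP; split => q /=; rewrite SigmaE swK.
  - by apply/bounded_setP; exists r => q /Pr; rewrite swn.
  - split=> //; rewrite -subset0 => -[[x l] e] [/= Pq [kq [e0 xl]]].
    have : (P `&` T) (x, e, l).
      split=> //; split; first by split=> //; exact/ksol.
      by move=> [ex _ el]; apply: xl; rewrite ex el.
    by rewrite PT.
have [K [KS Kc Kp KT]] := global_branch clSigma clT Sp Tp cptS nspl.
exists K; split=> //.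
  move=> q /KS[Sq nq]; split=> // S0q; apply: nq.
  by have [->|qp] := pselect (q = (xs, 0, ls)); [right|left; split].
case: KT => [|[q [S0q qp] Kq]]; [by left|right].
by exists q; split=> //; apply/eqP.
Qed.
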